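(* Let $k>0$, $c\in\mathbb{R}$, $x>0$, and let $\alpha,\eta,\lambda,v\in\mathbb{C}$ be such that $\Re(v)>-1$, $\Re(\alpha)>0$ and $\Re(\lambda+v)>0$. Then $$\left(K_{\eta,\alpha}^{+}\,t^{\frac{\lambda}{k}-1}W_{v,c}^{k}(t)\right)(x)=\frac{x^{\frac{v}{k}+\frac{\lambda}{k}-1}}{(2k)^{\frac{v}{k}}}\;{}_1\Psi_{2}\left[\begin{array}{c}\left(\frac{v}{k}+\frac{\lambda}{k}+\eta,2\right)\\ \left(\frac{v}{k}+\frac{\lambda}{k}+\alpha+\eta,2\right),\left(\frac{v}{k}+1,1\right)\end{array};-\frac{cx^2}{4k}\right].$$
   Context: The left-sided Erdélyi–Kober fractional integral is, for $x>0$, $\alpha,\eta\in\mathbb{C}$, $\Re(\alpha)>0$, $$\left(K_{\eta,\alpha}^{+}f\right)(x)=\frac{x^{-\alpha-\eta}}{\Gamma(\alpha)}\int_0^x (x-t)^{\alpha-1}t^{\eta}f(t)\,dt.$$ The notation $\left(K_{\eta,\alpha}^{+}g(t)\right)(x)$ means the operator applied to $t\mapsto g(t)$ on $(0,\infty)$ and evaluated at $x$. The $k$-Bessel function is $$W_{v,c}^{k}(z)=\sum_{n=0}^{\infty}\frac{(-c)^n}{\Gamma_k(nk+v+k)\,n!}\left(\frac{z}{2}\right)^{2n+\frac{v}{k}},$$ where $\Gamma_k(z)=\int_0^\infty t^{z-1}e^{-t^k/k}\,dt$ for $\Re(z)>0$, extended by $\Gamma_k(z)=k^{\frac{z}{k}-1}\Gamma\left(\frac{z}{k}\right)$.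 The Wright type hypergeometric function is $${}_p\Psi_q\left[\begin{array}{c}(a_1,A_1),\dots,(a_p,A_p)\\(b_1,B_1),\dots,(b_q,B_q)\end{array};z\right]=\sum_{n=0}^\infty\frac{\Gamma(a_1+A_1n)\cdots\Gamma(a_p+A_pn)}{\Gamma(b_1+B_1n)\cdots\Gamma(b_q+B_qn)}\frac{z^n}{n!},$$ with $A_i,B_j>0$ real and $1+\sum_j B_j-\sum_i A_i>0$. Reciprocals $1/\Gamma$ and $1/\Gamma_k$ are taken to be $0$ at the poles. Complex powers of positive reals are $y^s=e^{s\log y}$.
   Formalization: The equality is asserted whenever the integral on the left converges absolutely, which the stated hypotheses do not ensure for arbitrary η; convergence is also proved when Re(v/k+λ/k+η)>0. *)

(* Defs.v *)
From HB Require Import structures.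
From mathcomp Require Import all_boot all_order all_algebra.
From mathcomp Require Import all_classical all_reals all_analysis.
From mathcomp Require Import complex.

Set Implicit Arguments.
Unset Strict Implicit.
Unset Printing Implicit Defensive.

Import Order.TTheory GRing.Theory Num.Theory.
Import numFieldNormedType.Exports.

Local Open Scope classical_set_scope.
Local Open Scope ring_scope.
Local Open Scope complex_scope.

(* The projections of [R[i]] are [complex.Re] and [complex.Im], qualified because
   [Re] and [Im] are the [R[i]]-valued ones of [ssrnum] here. The topology of
   [R[i]] is the one carried by the alias [R[i]^o]. *)

Definition cexp {R : realType} (z : R[i]) : R[i] :=
  (expR (complex.Re z) * cos (complex.Im z)) +i*
  (expR (complex.Re z) * sin (complex.Im z)).

(* Meaningful for [0 < y] only. *)
Definition cpow {R : realType} (y : R) (s : R[i]) : R[i] :=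
  cexp (s * (ln y)%:C).

Definition csum {R : realType} (u : nat -> R[i]) : R[i] :=
  limn (series (u : nat -> R[i]^o)).

Definition cintegrable {R : realType} (D : set R) (f : R -> R[i]) : Prop :=
  (@lebesgue_measure R).-integrable D (fun t => (complex.Re (f t))%:E) /\
  (@lebesgue_measure R).-integrable D (fun t => (complex.Im (f t))%:E).

Definition cintegral {R : realType} (D : set R) (f : R -> R[i]) : R[i] :=
  (\int[@lebesgue_measure R]_(t in D) complex.Re (f t))%R +i*
  (\int[@lebesgue_measure R]_(t in D) complex.Im (f t))%R.

Definition Gamma_integral {R : realType} (z : R[i]) : R[i] :=
  cintegral `]0, +oo[ (fun t => cpow t (z - 1) * (expR (- t))%:C).

(* Outside [0 < Re z], the functional equation gives
   Gamma z = Gamma (z + n) / (z (z + 1) ... (z + n - 1)), where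
   n = (truncn (- Re z)).+1 is such that 0 < Re (z + n). At the poles 0, -1,
   -2, ... the denominator vanishes, so that [Gamma z = 0] and hence
   [(Gamma z)^-1 = 0], which is the convention for the reciprocal. *)
Definition Gamma {R : realType} (z : R[i]) : R[i] :=
  if 0 < complex.Re z then Gamma_integral z
  else let n := (Num.truncn (- complex.Re z)).+1 in
       Gamma_integral (z + n%:R) / \prod_(j < n) (z + j%:R).

(* As for [Gamma], the value and its inverse are 0 at the poles. *)
Definition Gammak {R : realType} (k : R) (z : R[i]) : R[i] :=
  if 0 < complex.Re z then
    cintegral `]0, +oo[
      (fun t => cpow t (z - 1) * (expR (- (t `^ k / k)))%:C)
  else cpow k (z / k%:C - 1) * Gamma (z / k%:C).

(* The k-Bessel function W_{v,c}^k on the positive half-line. *)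
Definition kBessel {R : realType} (k : R) (v : R[i]) (c : R) (z : R) : R[i] :=
  csum (fun n => (- c%:C) ^+ n / (Gammak k (n%:R * k%:C + v + k%:C) * n`!%:R)
                 * cpow (z / 2) (2 * n%:R + v / k%:C)).

(* [num] lists the pairs (a_i, A_i) and [den] the pairs (b_j, B_j); used with
   A_i, B_j > 0 and 1 + \sum_j B_j - \sum_i A_i > 0, when the series
   converges for every [z]. *)
Definition Wright {R : realType} (num den : seq (R[i] * R)) (z : R[i]) : R[i] :=
  csum (fun n => (\prod_(p <- num) Gamma (p.1 + p.2%:C * n%:R))
                 / (\prod_(p <- den) Gamma (p.1 + p.2%:C * n%:R))
                 * (z ^+ n / n`!%:R)).

Definition EK_integrand {R : realType} (eta alpha : R[i]) (f : R -> R[i])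
    (x t : R) : R[i] :=
  cpow (x - t) (alpha - 1) * cpow t eta * f t.

Definition EK_defined {R : realType} (eta alpha : R[i]) (f : R -> R[i])
    (x : R) : Prop :=
  cintegrable `]0, x[ (EK_integrand eta alpha f x).

(* The left-sided Erdelyi-Kober operator; its value is meaningful only under
   [EK_defined eta alpha f x]. *)
Definition EK {R : realType} (eta alpha : R[i]) (f : R -> R[i]) (x : R) : R[i] :=
  cpow x (- alpha - eta) / Gamma alpha
  * cintegral `]0, x[ (EK_integrand eta alpha f x).

(* Main.v *)
Require Import Defs.
From HB Require Import structures.
From mathcomp Require Import all_boot all_order all_algebra.
From mathcomp Require Import all_classical all_reals all_analysis.
From mathcomp Require Import measurable_realfun complex ring lra.

(** Expanding the Bessel function, the integrand of the Erdelyi-Kober operator is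
    the sum over n of u_n (x - t)^(alpha - 1) t^(a + 2n - 1), where
    a = v / k + lambda / k + eta and u_n is O(y^n / n!) for some y (lemmas
    [kBessel_cvg] and [bessel_coeff_bound]). Integrating term by term produces the
    beta integrals of (alpha, a + 2n) over ]0, x[; the identity between beta and
    gamma functions turns them, up to powers of x, into
    Gamma alpha Gamma (a + 2n) / Gamma (alpha + a + 2n), and the factor Gamma alpha
    is the one that the operator divides by. What remains is the Wright series,
    coefficient by coefficient.

    The identity between beta and gamma functions for complex arguments
    ([beta_gamma]) comes from the limit formula of Gauss. The recurrence
    (a + b) B(a + 1, b) = a B(a, b), an integration by parts, expresses
    B(a + n, b) by rising factorials; when N^b B(a + N + 1, b) is rescaled to
    ]0, N[, dominated convergence shows that it tends to Gamma b ([gauss_beta]).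
    For a = 0 this is the formula of Gauss, and the general case combines with it
    to give the identity. The functional equation of Gamma is the case a = 1, and
    Gamma has no zero in the right half-plane because the quotients of Gauss stay
    away from 0 ([Gamma_integral_neq0]).

    The integral may exist outside the range 0 < Re a, namely when the first n0
    coefficients u_n vanish. Near 0 the integrand is then comparable to
    t^(Re a + 2 n0 - 1), so that existence of the integral forces
    0 < Re a + 2 n0 ([integrable_exponent]). In both cases dominated convergence
    justifies the termwise integration from n0 on ([termwise_integration]), and the
    terms of index less than n0 are 0 on both sides, since they contain the factor
    u_n. Convergence of the Wright series is part of the conclusion of the dominated
    convergence theorem. *)

Set Implicit Arguments.
Unset Strict Implicit.
Unset Printing Implicit Defensive.

Import Order.TTheory GRing.Theory Num.Theory.
Import numFieldNormedType.Exports.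

Local Open Scope classical_set_scope.
Local Open Scope ring_scope.
Local Open Scope complex_scope.

Local Notation Re := complex.Re.
Local Notation Im := complex.Im.
Local Notation normc := ComplexField.Normc.normc.

(** * Complex numbers and their modulus *)

Section complex_numbers.
Context {R : realType}.
Implicit Types (x y : R) (z w s : R[i]).

Lemma complexP z w : Re z = Re w -> Im z = Im w -> z = w.
Proof. by case: z w => [a b] [c d] /= -> ->. Qed.

Lemma cReD z w : Re (z + w) = Re z + Re w. Proof. by case: z w => [? ?] []. Qed.
Lemma cImD z w : Im (z + w) = Im z + Im w. Proof. by case: z w => [? ?] []. Qed.
Lemma cReN z : Re (- z) = - Re z. Proof. by case: z. Qed.
Lemma cImN z : Im (- z) = - Im z. Proof. by case: z. Qed.
Lemma cReM z w : Re (z * w) = Re z * Re w - Im z * Im w.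
Proof. by case: z w => [? ?] []. Qed.
Lemma cImM z w : Im (z * w) = Re z * Im w + Im z * Re w.
Proof. by case: z w => [? ?] []. Qed.
Lemma cReMr z x : Re (z * x%:C) = Re z * x.
Proof. by rewrite cReM /= mulr0 subr0. Qed.
Lemma cImMr z x : Im (z * x%:C) = Im z * x.
Proof. by rewrite cImM /= mulr0 add0r. Qed.
Lemma natC n : n%:R = (n%:R : R)%:C :> R[i].
Proof. by rewrite rmorph_nat. Qed.
Lemma cRe_nat n : Re (n%:R : R[i]) = n%:R. Proof. by rewrite natC. Qed.

Lemma cRe_sum (I : Type) (r : seq I) (P : pred I) (F : I -> R[i]) :
  Re (\sum_(i <- r | P i) F i) = \sum_(i <- r | P i) Re (F i).
Proof. by elim/big_rec2: _ => // i u v _ <-; rewrite cReD. Qed.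
Lemma cIm_sum (I : Type) (r : seq I) (P : pred I) (F : I -> R[i]) :
  Im (\sum_(i <- r | P i) F i) = \sum_(i <- r | P i) Im (F i).
Proof. by elim/big_rec2: _ => // i u v _ <-; rewrite cImD. Qed.

Lemma normc_ge0 z : 0 <= normc z.
Proof. by case: z => a b; exact: sqrtr_ge0. Qed.
Lemma normc_real x : normc x%:C = `|x|.
Proof. by rewrite /= expr0n/= addr0 sqrtr_sqr. Qed.
Lemma normc_nat n : normc (n%:R : R[i]) = n%:R.
Proof. by rewrite natC normc_real ger0_norm. Qed.
Lemma normcX z n : normc (z ^+ n) = normc z ^+ n.
Proof.
elim: n => [|n IH]; first by rewrite !expr0 ComplexField.Normc.normc1.
by rewrite !exprS ComplexField.Normc.normcM IH.
Qed.
Lemma normc_eq0 z : (normc z == 0) = (z == 0).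
Proof.
apply/eqP/eqP => [/ComplexField.Normc.eq0_normc//|->].
exact: ComplexField.Normc.normc0.
Qed.
Lemma normc_sum (I : Type) (r : seq I) (P : pred I) (F : I -> R[i]) :
  normc (\sum_(i <- r | P i) F i) <= \sum_(i <- r | P i) normc (F i).
Proof.
elim/big_rec2: _ => [|i u v _ le_uv]; first by rewrite ComplexField.Normc.normc0.
by rewrite (le_trans (le_normcD _ _))// lerD2l.
Qed.

Lemma normr_Re_le z : `|Re z| <= normc z.
Proof. by case: z => a b /=; rewrite -sqrtr_sqr ler_wsqrtr// lerDl sqr_ge0. Qed.
Lemma normr_Im_le z : `|Im z| <= normc z.
Proof. by case: z => a b /=; rewrite -sqrtr_sqr ler_wsqrtr// lerDr sqr_ge0. Qed.
Lemma normc_le z : normc z <= `|Re z| + `|Im z|.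
Proof.
case: z => a b /=; rewrite -[leRHS]ger0_norm ?addr_ge0// -sqrtr_sqr.
rewrite ler_wsqrtr// sqrrD !real_normK ?num_real// lerD2r lerDl.
by rewrite mulrn_wge0// mulr_ge0.
Qed.

End complex_numbers.

(** * The complex exponential and powers of positive reals *)

Section complex_exponential.
Context {R : realType}.
Implicit Types (x y : R) (z w s : R[i]).

Lemma cexpD z w : cexp (z + w) = cexp z * cexp w.
Proof.
rewrite /cexp cReD cImD expRD cosD sinD; apply: complexP => /=.
  by ring.
by ring.
Qed.

Lemma cexp_real x : cexp x%:C = (expR x)%:C.
Proof. by rewrite /cexp /= cos0 sin0 mulr1 mulr0. Qed.

Lemma cexp0 : cexp 0 = 1 :> R[i].
Proof. by rewrite (cexp_real 0) expR0. Qed.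

Lemma normc_cexp z : normc (cexp z) = expR (Re z).
Proof.
rewrite /= !exprMn -mulrDr cos2Dsin2 mulr1 sqrtr_sqr ger0_norm//.
Qed.

Lemma cexp_neq0 z : cexp z != 0.
Proof. by rewrite -normc_eq0 normc_cexp expR_eq0. Qed.

Lemma cexpN z : cexp (- z) = (cexp z)^-1.
Proof.
apply: (mulfI (cexp_neq0 z)); rewrite -cexpD subrr cexp0 mulfV//.
exact: cexp_neq0.
Qed.

Lemma cpowD y s w : cpow y (s + w) = cpow y s * cpow y w.
Proof. by rewrite /cpow mulrDl cexpD. Qed.

Lemma cpowN y s : cpow y (- s) = (cpow y s)^-1.
Proof. by rewrite /cpow mulNr cexpN. Qed.

Lemma cpowB y s w : cpow y (s - w) = cpow y s / cpow y w.
Proof. by rewrite cpowD cpowN. Qed.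

Lemma cpow0 y : cpow y 0 = 1.
Proof. by rewrite /cpow mul0r cexp0. Qed.

Lemma cpow_neq0 y s : cpow y s != 0.
Proof. exact: cexp_neq0. Qed.

Lemma cpow_real y x : 0 < y -> cpow y x%:C = (y `^ x)%:C.
Proof. by move=> y0; rewrite /cpow -rmorphM cexp_real /powR gt_eqF. Qed.

Lemma cpow1 y : 0 < y -> cpow y 1 = y%:C.
Proof. by move=> y0; rewrite (cpow_real 1)// powRr1// ltW. Qed.

Lemma cpow_nat y n : 0 < y -> cpow y n%:R = y%:C ^+ n.
Proof. by move=> y0; rewrite natC cpow_real// powR_mulrn ?rmorphXn// ltW. Qed.

Lemma cpow1l s : cpow 1 s = 1.
Proof. by rewrite /cpow ln1 mulr0 cexp0. Qed.

Lemma cpowM x y s : 0 < x -> 0 < y -> cpow (x * y) s = cpow x s * cpow y s.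
Proof.
by move=> x0 y0; rewrite /cpow lnM// rmorphD mulrDr cexpD.
Qed.

Lemma cpowV x s : 0 < x -> cpow x^-1 s = (cpow x s)^-1.
Proof.
by move=> x0; rewrite /cpow lnV// rmorphN mulrN cexpN.
Qed.

Lemma cpow_powR y x s : cpow (y `^ x) s = cpow y (x%:C * s).
Proof.
by rewrite /cpow ln_powR rmorphM mulrA [s * _]mulrC.
Qed.

Lemma normc_cpow y s : 0 < y -> normc (cpow y s) = y `^ Re s.
Proof. by move=> y0; rewrite normc_cexp cReMr /powR gt_eqF. Qed.

End complex_exponential.

(** * Convergence of complex sequences *)

Section complex_limits.
Context {R : realType}.
Implicit Types (u v : nat -> R[i]) (a b : R[i]).

(** Convergence by components, so that the limit theory of real sequences applies
    verbatim; [ccvgP] gives back convergence for the modulus. *)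
Definition ccvg u a :=
  (fun n => Re (u n)) @ \oo --> Re a /\ (fun n => Im (u n)) @ \oo --> Im a.

Lemma ccvg_unique u a b : ccvg u a -> ccvg u b -> a = b.
Proof.
move=> [ua ua'] [ub ub']; apply: complexP.
  exact: cvg_unique ua ub.
exact: cvg_unique ua' ub'.
Qed.

Lemma ccvg_cst a : ccvg (fun=> a) a.
Proof. by split; exact: cvg_cst. Qed.

Lemma ccvgM u v a b : ccvg u a -> ccvg v b -> ccvg (fun n => u n * v n) (a * b).
Proof.
move=> [ua ua'] [vb vb']; split.
  rewrite cReM; under eq_cvg do rewrite cReM.
  by apply: cvgB; apply: cvgM.
rewrite cImM; under eq_cvg do rewrite cImM.
by apply: cvgD; apply: cvgM.
Qed.

Lemma ccvg_eq u v a : (\forall n \near \oo, u n = v n) -> ccvg u a -> ccvg v a.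
Proof.
move=> uv [h1 h2]; split.
  apply: cvg_trans h1; apply: near_eq_cvg.
  by apply: filterS uv => n ->.
apply: cvg_trans h2; apply: near_eq_cvg.
by apply: filterS uv => n ->.
Qed.

(** [csum] is a limit for the topology given by the modulus, which is at most
    the sum of the moduli of the components. *)
Lemma ccvgP u a : ccvg u a -> (u : nat -> R[i]^o) @ \oo --> (a : R[i]^o).
Proof.
move=> [h1 h2]; apply/(@cvgrPdist_lt _ (R[i]^o)) => e e0.
have [e' e'0 ->] : exists2 e' : R, 0 < e' & e = e'%:C.
  move: e0; rewrite ltcE /= => /andP[/eqP ei er].
  by exists (Re e) => //; apply: complexP.
have e20 : 0 < e' / 2 by rewrite divr_gt0.
move/cvgrPdist_lt : h1 => /(_ _ e20); move/cvgrPdist_lt : h2 => /(_ _ e20).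
apply: filterS2 => n nIm nRe.
change (`|a - u n| < e'%:C).
rewrite normc_def ltcR.
rewrite (_ : Num.sqrt _ = normc (a - u n)); last by case: (a - u n).
rewrite (le_lt_trans (normc_le _))// (splitr e') ltrD//.
  by rewrite cReD cReN.
by rewrite cImD cImN.
Qed.

Lemma csumE u a : ccvg (series u) a -> csum u = a.
Proof.
by move=> /ccvgP ua; apply: (@cvg_lim (R[i]^o)); first exact: norm_hausdorff.
Qed.

End complex_limits.

(** * Derivatives of complex functions of a real variable *)

Section complex_calculus.
Context {R : realType}.
Implicit Types (f g : R -> R[i]) (t : R).

(** As for limits, derivatives and continuity are taken by components. *)
Definition is_cderive f t (d : R[i]) :=
  is_derive t (1 : R) (fun u => Re (f u)) (Re d) /\
  is_derive t (1 : R) (fun u => Im (f u)) (Im d).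

Definition ccont f t :=
  {for t, continuous (fun u => Re (f u))} /\
  {for t, continuous (fun u => Im (f u))}.

Lemma is_derive_continuous (F : R -> R) t (d : R) :
  is_derive t (1 : R) F d -> {for t, continuous F}.
Proof.
move=> dF; apply/differentiable_continuous/derivable1_diffP.
exact: (@ex_derive _ _ _ _ _ _ _ dF).
Qed.

Lemma is_cderive_ccont f t d : is_cderive f t d -> ccont f t.
Proof. by move=> [h1 h2]; split; apply: is_derive_continuous; eassumption. Qed.

Lemma ccont_cst (z : R[i]) t : ccont (fun=> z) t.
Proof. by split; exact: cvg_cst. Qed.

Lemma ccontD f g t : ccont f t -> ccont g t -> ccont (fun u => f u + g u) t.
Proof.
move=> [f1 f2] [g1 g2]; split.
  rewrite (_ : (fun u => _) = (fun u => Re (f u) + Re (g u))); first exact: cvgD.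
  by apply/funext => u; rewrite cReD.
rewrite (_ : (fun u => _) = (fun u => Im (f u) + Im (g u))); first exact: cvgD.
by apply/funext => u; rewrite cImD.
Qed.

Lemma ccontM f g t : ccont f t -> ccont g t -> ccont (fun u => f u * g u) t.
Proof.
move=> [f1 f2] [g1 g2]; split.
  rewrite (_ : (fun u => _) = (fun u => Re (f u) * Re (g u) - Im (f u) * Im (g u))).
    by apply: cvgB; apply: cvgM.
  by apply/funext => u; rewrite cReM.
rewrite (_ : (fun u => _) = (fun u => Re (f u) * Im (g u) + Im (f u) * Re (g u))).
  by apply: cvgD; apply: cvgM.
by apply/funext => u; rewrite cImM.
Qed.

Lemma is_cderiveM f g t (df dg : R[i]) : is_cderive f t df -> is_cderive g t dg ->
  is_cderive (fun u => f u * g u) t (df * g t + f t * dg).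
Proof.
move=> [f1 f2] [g1 g2]; split.
  rewrite (_ : (fun u => _) = (fun u => Re (f u)) * (fun u => Re (g u)) -
                              (fun u => Im (f u)) * (fun u => Im (g u))).
    apply: is_derive_eq; rewrite cReD !cReM /GRing.scale /=; ring.
  by apply/funext => u; rewrite cReM.
rewrite (_ : (fun u => _) = (fun u => Re (f u)) * (fun u => Im (g u)) +
                            (fun u => Im (f u)) * (fun u => Re (g u))).
  apply: is_derive_eq; rewrite cImD !cImM /GRing.scale /=; ring.
by apply/funext => u; rewrite cImM.
Qed.

(** Both complex powers in a beta integrand, cpow t s and cpow (x - t) s, are
    exponentials of a constant multiple of a real logarithm. *)
Lemma is_cderive_cexp (l : R -> R) (s : R[i]) t (dl : R) :
  is_derive t (1 : R) l dl ->
  is_cderive (fun u => cexp (s * (l u)%:C)) t (s * dl%:C * cexp (s * (l t)%:C)).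
Proof.
move=> dlt.
have d1 : is_derive t (1 : R) (fun u => Re s * l u) (Re s * dl).
  exact: (@is_deriveZ _ _ _ l (Re s) t 1 dl dlt).
have d2 : is_derive t (1 : R) (fun u => Im s * l u) (Im s * dl).
  exact: (@is_deriveZ _ _ _ l (Im s) t 1 dl dlt).
have dE := @is_derive1_comp R expR (fun u => Re s * l u) t _ _
  (is_derive_expR (Re s * l t)) d1.
have dC := @is_derive1_comp R cos (fun u => Im s * l u) t _ _
  (is_derive_cos (Im s * l t)) d2.
have dS := @is_derive1_comp R sin (fun u => Im s * l u) t _ _
  (is_derive_sin (Im s * l t)) d2.
split.
  rewrite (_ : (fun u => _) = (expR \o (fun u => Re s * l u)) *
                              (cos \o (fun u => Im s * l u))).
    apply: is_derive_eq => /=.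
    rewrite cReM cReMr cImMr /cexp /= cReMr cImMr /GRing.scale /=; ring.
  by apply/funext => u; rewrite /= cReMr cImMr.
rewrite (_ : (fun u => _) = (expR \o (fun u => Re s * l u)) *
                            (sin \o (fun u => Im s * l u))).
  apply: is_derive_eq.
  rewrite cImM cReMr cImMr /cexp /= cReMr cImMr /GRing.scale /=; ring.
by apply/funext => u; rewrite /= cReMr cImMr.
Qed.

Lemma is_cderive_cpow (s : R[i]) t : 0 < t ->
  is_cderive (fun u => cpow u s) t (s * cpow t (s - 1)).
Proof.
move=> t0; have := is_cderive_cexp s (is_derive1_ln t0).
by rewrite cpowB cpow1// fmorphV/= -mulrA [_^-1 * _]mulrC.
Qed.

Lemma is_derive_subl x t : is_derive t (1 : R) (fun u => x - u) (- 1).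
Proof.
rewrite (_ : (fun u => _) = (cst x - id)) //.
by apply: is_derive_eq; rewrite sub0r.
Qed.

Lemma is_cderive_cpowB x (s : R[i]) t : t < x ->
  is_cderive (fun u => cpow (x - u) s) t (- (s * cpow (x - t) (s - 1))).
Proof.
move=> tx; have tx0 : 0 < x - t by rewrite subr_gt0.
have := is_cderive_cexp s (@is_derive1_comp R (@ln R) (fun u => x - u) t _ _
  (is_derive1_ln tx0) (is_derive_subl x t)).
rewrite /= cpowB cpow1// mulrN1 rmorphN/= fmorphV/= mulrN mulNr.
by rewrite -mulrA [_^-1 * _]mulrC.
Qed.

Lemma ccont_cpow (s : R[i]) t : 0 < t -> ccont (fun u => cpow u s) t.
Proof. by move=> /(is_cderive_cpow s)/is_cderive_ccont. Qed.

Lemma ccont_cpowB x (s : R[i]) t : t < x -> ccont (fun u => cpow (x - u) s) t.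
Proof. by move=> /(is_cderive_cpowB s)/is_cderive_ccont. Qed.

End complex_calculus.

(** * Integrals over open intervals with singular ends *)

Section exhaustion.
Context {R : realType}.
Notation mu := (@lebesgue_measure R).
Implicit Types (c d : nat -> R) (D E : set R) (f g F : R -> R).

(** A function continuous inside an interval D may be singular at its ends: its
    integral over D is obtained as the limit of its integrals over compact
    intervals increasing to D. *)
Definition exhausts c d D :=
  [/\ {homo c : m n / (m <= n)%N >-> n <= m},
      {homo d : m n / (m <= n)%N >-> m <= n},
      forall n, c n < d n &
      \bigcup_n [set` `[c n, d n]] = D].

Lemma exhausts_sub c d D n : exhausts c d D -> [set` `[c n, d n]] `<=` D.
Proof. by case=> _ _ _ <- t tn; exists n. Qed.

Lemma exhausts_nd c d D : exhausts c d D ->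
  nondecreasing_seq (fun n => [set` `[c n, d n]] : set R).
Proof.
move=> [hc hd _ _] m n mn; apply/subsetPset => t /=; rewrite !in_itv/=.
by move=> /andP[ct td]; rewrite (le_trans (hc _ _ mn) ct) (le_trans td (hd _ _ mn)).
Qed.

Lemma exhausts_measurable c d D : exhausts c d D -> measurable D.
Proof. by case=> _ _ _ <-; exact: bigcup_measurable. Qed.

Lemma ge0_exhaust_cvg c d D f : exhausts c d D ->
  measurable_fun D f -> (forall t, D t -> 0 <= f t) ->
  (\int[mu]_(t in `[c n, d n]) (f t)%:E)%E @[n --> \oo] -->
  (\int[mu]_(t in D) (f t)%:E)%E.
Proof.
move=> ex mf f0; have [_ _ _ DE] := ex; rewrite -[in X in _ --> X]DE.
apply: ge0_nondecreasing_set_cvg_integral.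
- exact: exhausts_nd ex.
- by [].
- move=> n; apply/measurable_EFinP; apply: measurable_funS mf.
    exact: exhausts_measurable ex.
  exact: exhausts_sub ex.
- by move=> n t /(exhausts_sub ex) /f0; rewrite lee_fin.
Qed.

Lemma exhaust_cvg c d D f : exhausts c d D -> mu.-integrable D (EFin \o f) ->
  (\int[mu]_(t in `[c n, d n]) f t) @[n --> \oo] --> \int[mu]_(t in D) f t.
Proof.
move=> ex fi; have mD := exhausts_measurable ex.
have mf : measurable_fun D f by apply/measurable_EFinP; exact: measurable_int fi.
pose fn n := f \_ [set` `[c n, d n]].
have intE n : \int[mu]_(t in `[c n, d n]) f t = fine (\int[mu]_(t in D) (fn n t)%:E).
  rewrite -[RHS]/(\int[mu]_(t in D) fn n t) -Rintegral_mkcondr.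
  congr (Rintegral _ _ _); apply/esym/setIidPr.
  exact: (exhausts_sub ex).
under eq_cvg do rewrite intE.
apply: fine_cvg; rewrite fineK; last exact: integrable_fin_num.
have [| | | | |_ _] := @dominated_convergence _ _ _ mu D mD (fun n => EFin \o fn n)
  (EFin \o f) (abse \o (EFin \o f)).
- move=> n; apply/measurable_EFinP/measurable_restrict => //.
  by apply: measurable_funS mf.
- exact/measurable_EFinP.
- apply: aeW => t Dt; have [_ _ _ DE] := ex.
  have [N _ Nt] : (\bigcup_n [set` `[c n, d n]]) t by rewrite DE.
  apply: cvg_near_cst; near=> n.
  rewrite /= /fn patchE mem_set//.
  have Nn : (N <= n)%N by near: n; exact: nbhs_infty_ge.
  by have /subsetPset := exhausts_nd ex Nn; apply.
- exact: integrable_abse.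
- apply: aeW => t n Dt /=; rewrite lee_fin /fn patchE; case: ifPn => // _.
  by rewrite normr0.
- by [].
Unshelve. all: by end_near. Qed.

Lemma exhaust_FTC2 c d D f F n : exhausts c d D ->
  {in D, continuous f} -> (forall t, D t -> is_derive t (1 : R) F (f t)) ->
  (\int[mu]_(t in `[c n, d n]) (f t)%:E = (F (d n))%:E - (F (c n))%:E)%E.
Proof.
move=> ex cf dF; have [_ _ cd _] := ex.
have sub := @exhausts_sub _ _ _ n ex.
have cF t : D t -> {for t, continuous F} by move=> /dF; exact: is_derive_continuous.
apply: continuous_FTC2 => //.
- apply: continuous_in_subspaceT => t /set_mem/sub Dt.
  by apply: cf; rewrite inE.
- split.
  + move=> t /subset_itv_oo_cc tcd; have Dt : D t by exact: sub.
    exact: (@ex_derive _ _ _ _ _ _ _ (dF _ Dt)).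
  + apply: cvg_at_right_filter; apply: cF; apply: sub.
    by rewrite /= in_itv/= lexx ltW.
  + apply: cvg_at_left_filter; apply: cF; apply: sub.
    by rewrite /= in_itv/= lexx ltW.
- move=> t /subset_itv_oo_cc tcd; have Dt : D t by exact: sub.
  by rewrite derive1E (@derive_val _ _ _ _ _ _ _ (dF _ Dt)).
Qed.

(** For a nonnegative function, having a primitive with finite limits at the two
    ends is enough to be integrable, by monotone convergence. *)
Lemma ge0_FTC_integrable c d D f F (A B : R) : exhausts c d D -> open D ->
  (forall t, D t -> 0 <= f t) ->
  {in D, continuous f} -> (forall t, D t -> is_derive t (1 : R) F (f t)) ->
  F (c n) @[n --> \oo] --> A -> F (d n) @[n --> \oo] --> B ->
  mu.-integrable D (EFin \o f).
Proof.
move=> ex oD f0 cf dF FA FB.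
have mf : measurable_fun D f by exact: open_continuous_measurable_fun.
apply/integrableP; split; first exact/measurable_EFinP.
rewrite (@eq_integral _ _ _ mu D (fun t => (f t)%:E)); last first.
  by move=> t /set_mem /f0 ft; rewrite /= ger0_norm.
suff -> : (\int[mu]_(t in D) (f t)%:E = (B - A)%:E)%E by rewrite ltry.
have h := ge0_exhaust_cvg ex mf f0.
apply: (cvg_unique (@ereal_hausdorff R) h) => /=.
under eq_cvg do rewrite (exhaust_FTC2 _ ex cf dF) -EFinB.
apply: cvg_EFin; first exact: nearW.
exact: cvgB.
Qed.

Lemma FTC_open c d D f F (A B : R) : exhausts c d D ->
  mu.-integrable D (EFin \o f) ->
  {in D, continuous f} -> (forall t, D t -> is_derive t (1 : R) F (f t)) ->
  F (c n) @[n --> \oo] --> A -> F (d n) @[n --> \oo] --> B ->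
  \int[mu]_(t in D) f t = B - A.
Proof.
move=> ex fi cf dF FA FB; have h := exhaust_cvg ex fi.
apply: (cvg_unique (@Rhausdorff R) h) => /=.
under eq_cvg do rewrite /Rintegral (exhaust_FTC2 _ ex cf dF) -EFinB /=.
exact: cvgB.
Qed.

Section substitution.
Variables (c d : nat -> R) (D E : set R) (p p' : R -> R).
Hypotheses (exD : exhausts c d D) (exE : exhausts (p \o c) (p \o d) E).
Hypotheses (p_incr : forall s t, D s -> D t -> s < t -> p s < p t).
Hypotheses (dp : forall t, D t -> is_derive t (1 : R) p (p' t))
  (p'_ge0 : forall t, D t -> 0 <= p' t) (cp' : {in D, continuous p'}).
Hypotheses (oD : open D) (oE : open E).

Lemma substitution_maps t : D t -> E (p t).
Proof.
have [_ _ cd DE] := exD; rewrite -{1}DE => -[n _ tn].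
apply: (exhausts_sub (n := n) exE); move: (tn); rewrite /= !in_itv/= => /andP[ct td].
have Dc : D (c n) by apply: (exhausts_sub (n := n) exD); rewrite /= in_itv/= lexx ltW.
have Dd : D (d n) by apply: (exhausts_sub (n := n) exD); rewrite /= in_itv/= lexx ltW.
have Dt : D t by exact: (exhausts_sub (n := n) exD).
apply/andP; split.
  by move: ct; rewrite le_eqVlt => /predU1P[->//|ct]; exact/ltW/p_incr.
by move: td; rewrite le_eqVlt => /predU1P[->//|td]; exact/ltW/p_incr.
Qed.

Lemma substitution_cont f : {in E, continuous f} ->
  {in D, continuous (fun t => f (p t) * p' t)}.
Proof.
move=> cf t /set_mem Dt; apply: cvgM; last by apply: cp'; rewrite inE.
apply: continuous_comp; first exact: is_derive_continuous (dp Dt).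
by apply: cf; rewrite inE; exact: substitution_maps.
Qed.

(** On a compact interval, the usual substitution for continuous functions. *)
Lemma substitution_step f n : {in E, continuous f} ->
  (\int[mu]_(u in `[p (c n), p (d n)]) (f u)%:E =
   \int[mu]_(t in `[c n, d n]) (f (p t) * p' t)%:E)%E.
Proof.
move=> cf; have [_ _ cd _] := exD.
have subD := @exhausts_sub _ _ _ n exD; have subE := @exhausts_sub _ _ _ n exE.
have Dc : D (c n) by apply: subD; rewrite /= in_itv/= lexx ltW.
have Dd : D (d n) by apply: subD; rewrite /= in_itv/= lexx ltW.
have p'E t : D t -> derive1 p t = p' t.
  by move=> Dt; rewrite derive1E (@derive_val _ _ _ _ _ _ _ (dp Dt)).
have cvgp' t : D t -> derive1 p u @[u --> t] --> p' t.
  move=> Dt; apply: (@cvg_trans _ (p' u @[u --> t])); last by apply: cp'; rewrite inE.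
  apply: near_eq_cvg; near=> u; rewrite p'E//.
  by near: u; apply: (@open_nbhs_nbhs _ t D); split.
rewrite (@integration_by_substitution_increasing _ p f (c n) (d n)) //.
- apply: eq_integral => t /set_mem tcd; rewrite -p'E//.
  exact: subD.
- exact: ltW.
- by move=> s t sn tn; apply: p_incr; exact: subD.
- move=> t /subset_itv_oo_cc/subD Dt; rewrite /prop_for /continuous_at p'E//.
  exact: cvgp'.
- by apply/cvg_ex; exists (p' (c n)); apply: cvg_at_right_filter; exact: cvgp'.
- by apply/cvg_ex; exists (p' (d n)); apply: cvg_at_left_filter; exact: cvgp'.
- split.
  + move=> t /subset_itv_oo_cc/subD Dt.
    exact: (@ex_derive _ _ _ _ _ _ _ (dp Dt)).
  + by apply: cvg_at_right_filter; exact: is_derive_continuous (dp Dc).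
  + by apply: cvg_at_left_filter; exact: is_derive_continuous (dp Dd).
- apply: continuous_in_subspaceT => t /set_mem/subE Et.
  by apply: cf; rewrite inE.
Unshelve. all: by end_near. Qed.

(** Monotone convergence in the compact case, applied to the absolute value. *)
Lemma substitution_integrable f : {in E, continuous f} ->
  mu.-integrable E (EFin \o f) ->
  mu.-integrable D (EFin \o (fun t => f (p t) * p' t)).
Proof.
move=> cf fi; apply/integrableP; split.
  apply/measurable_EFinP; apply: open_continuous_measurable_fun => //.
  exact: substitution_cont.
have cnf : {in E, continuous (fun u => `|f u|)}.
  by move=> u uE; apply: cvg_norm; exact: cf.
rewrite (@eq_integral _ _ _ mu D (fun t => (`|f (p t)| * p' t)%:E)); last first.
  by move=> t /set_mem Dt /=; rewrite normrM [X in _ * X]ger0_norm// p'_ge0.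
suff -> : (\int[mu]_(t in D) (`|f (p t)| * p' t)%:E =
           \int[mu]_(u in E) `|(EFin \o f) u|)%E by case/integrableP : fi.
have h1 := @ge0_exhaust_cvg _ _ _ (fun t => `|f (p t)| * p' t) exD.
have h2 := @ge0_exhaust_cvg _ _ _ (fun t => `|f t|) exE.
apply: (cvg_unique (@ereal_hausdorff R) (h1 _ _)) => /=.
- apply: open_continuous_measurable_fun => //.
  exact: (substitution_cont cnf).
- by move=> t Dt; rewrite mulr_ge0// p'_ge0.
- under eq_cvg do rewrite -(substitution_step _ cnf).
  by apply: h2 => //; exact: open_continuous_measurable_fun.
Qed.

Lemma substitution f : {in E, continuous f} -> mu.-integrable E (EFin \o f) ->
  \int[mu]_(u in E) f u = \int[mu]_(t in D) (f (p t) * p' t).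
Proof.
move=> cf fi; have h1 := exhaust_cvg exE fi.
have h2 := exhaust_cvg exD (substitution_integrable cf fi).
apply: (cvg_unique (@Rhausdorff R) h1) => /=.
under eq_cvg do rewrite /Rintegral (substitution_step _ cf).
exact: h2.
Qed.

End substitution.
End exhaustion.

(** * Integrals of complex functions *)

Section complex_integral.
Context {R : realType}.
Notation mu := (@lebesgue_measure R).
Implicit Types (D E : set R) (f g F : R -> R[i]) (z : R[i]).

Definition cmeasurable D f :=
  measurable_fun D (fun t => Re (f t)) /\ measurable_fun D (fun t => Im (f t)).

Lemma integrable_ext D (F G : R -> \bar R) : measurable D ->
  mu.-integrable D F -> (forall t, D t -> F t = G t) -> mu.-integrable D G.
Proof.
move=> mD Fi FG; apply: (@eq_integrable _ _ _ mu D mD F) => //.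
by move=> t /set_mem; exact: FG.
Qed.

Lemma ccont_measurable D f : open D -> (forall t, D t -> ccont f t) ->
  cmeasurable D f.
Proof.
move=> oD cf; split; apply: open_continuous_measurable_fun => // t /set_mem Dt.
  by have [] := cf _ Dt.
by have [] := cf _ Dt.
Qed.

(** The modulus dominates both components, whence their integrability. *)
Lemma cintegrable_le D f (g : R -> R) : measurable D -> cmeasurable D f ->
  mu.-integrable D (EFin \o g) -> (forall t, D t -> normc (f t) <= g t) ->
  cintegrable D f.
Proof.
move=> mD [m1 m2] gi fg; split; apply: le_integrable gi => //.
- exact/measurable_EFinP.
- move=> t Dt; rewrite lee_fin (le_trans (normr_Re_le _))//.
  by rewrite (le_trans (fg _ Dt))// ler_norm.
- exact/measurable_EFinP.
- move=> t Dt; rewrite lee_fin (le_trans (normr_Im_le _))//.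
  by rewrite (le_trans (fg _ Dt))// ler_norm.
Qed.

Lemma eq_cintegral D f g : (forall t, D t -> f t = g t) ->
  cintegral D f = cintegral D g.
Proof.
move=> fg; rewrite /cintegral; congr (_ +i* _);
  by apply: eq_Rintegral => t /set_mem Dt; rewrite fg.
Qed.

Lemma eq_cintegrable D f g : measurable D -> (forall t, D t -> f t = g t) ->
  cintegrable D f -> cintegrable D g.
Proof.
move=> mD fg [h1 h2]; split.
  by apply: integrable_ext h1 _ => // t Dt; rewrite fg.
by apply: integrable_ext h2 _ => // t Dt; rewrite fg.
Qed.

Lemma cintegrable_cmeasurable D f : cintegrable D f -> cmeasurable D f.
Proof.
move=> [h1 h2]; split; apply/measurable_EFinP.
  exact: measurable_int h1.
exact: measurable_int h2.
Qed.

Lemma cintegrable_add D f g : measurable D -> cintegrable D f -> cintegrable D g ->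
  cintegrable D (fun t => f t + g t).
Proof.
move=> mD [f1 f2] [g1 g2]; split.
  apply: (integrable_ext mD (@integrableD _ _ _ mu D mD _ _ f1 g1)) => t _.
  by rewrite /= cReD.
apply: (integrable_ext mD (@integrableD _ _ _ mu D mD _ _ f2 g2)) => t _.
by rewrite /= cImD.
Qed.

Lemma cintegral_add D f g : measurable D -> cintegrable D f -> cintegrable D g ->
  cintegral D (fun t => f t + g t) = cintegral D f + cintegral D g.
Proof.
move=> mD [f1 f2] [g1 g2]; apply: complexP.
  rewrite cReD /= -RintegralD//; apply: eq_Rintegral => t _; exact: cReD.
rewrite cImD /= -RintegralD//; apply: eq_Rintegral => t _; exact: cImD.
Qed.

Lemma cintegrableZl D z f : measurable D -> cintegrable D f ->
  cintegrable D (fun t => z * f t).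
Proof.
move=> mD [f1 f2]; split.
  apply: (integrable_ext mD (@integrableB _ _ _ mu D mD _ _
    (@integrableZl _ _ _ mu D mD (Re z) _ f1)
    (@integrableZl _ _ _ mu D mD (Im z) _ f2))) => t _.
  by rewrite /= cReM.
apply: (integrable_ext mD (@integrableD _ _ _ mu D mD _ _
  (@integrableZl _ _ _ mu D mD (Re z) _ f2)
  (@integrableZl _ _ _ mu D mD (Im z) _ f1))) => t _.
by rewrite /= cImM.
Qed.

Lemma integrable_mulE D (r : R) (h : R -> R) : measurable D ->
  mu.-integrable D (EFin \o h) -> mu.-integrable D (EFin \o (fun t => r * h t)).
Proof. by move=> mD hi; exact: integrable_ext (@integrableZl _ _ _ mu D mD r _ hi) _. Qed.

Lemma cintegralZl D z f : measurable D -> cintegrable D f ->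
  cintegral D (fun t => z * f t) = z * cintegral D f.
Proof.
move=> mD [f1 f2]; apply: complexP.
  rewrite cReM /= -!RintegralZl// -RintegralB//; [|exact: integrable_mulE..].
  by apply: eq_Rintegral => t _; exact: cReM.
rewrite cImM /= -!RintegralZl// -RintegralD//; [|exact: integrable_mulE..].
by apply: eq_Rintegral => t _; exact: cImM.
Qed.

Lemma cintegral0 D : cintegral D (fun=> 0) = 0.
Proof. by rewrite /cintegral /= /Rintegral !integral0. Qed.

Lemma cintegrable_sum D (f : nat -> R -> R[i]) n : measurable D ->
  (forall j, cintegrable D (f j)) -> cintegrable D (fun t => \sum_(0 <= j < n) f j t).
Proof.
move=> mD fi; elim: n => [|n IH].
  apply: (@eq_cintegrable _ (fun=> 0)) => // [t _|]; first by rewrite big_geq.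
  by split; exact: integrable0.
apply: eq_cintegrable (cintegrable_add mD IH (fi n)) => // t _.
by rewrite big_nat_recr.
Qed.

Lemma cintegral_sum D (f : nat -> R -> R[i]) n : measurable D ->
  (forall j, cintegrable D (f j)) ->
  cintegral D (fun t => \sum_(0 <= j < n) f j t) = \sum_(0 <= j < n) cintegral D (f j).
Proof.
move=> mD fi; elim: n => [|n IH].
  by rewrite big_geq// -[RHS](cintegral0 D); apply: eq_cintegral => t _; rewrite big_geq.
rewrite big_nat_recr//= -IH -cintegral_add//; last exact: cintegrable_sum.
by apply: eq_cintegral => t _; rewrite big_nat_recr.
Qed.

Lemma dominated_real D (u : nat -> R -> R) (f g : R -> R) : measurable D ->
  (forall n, measurable_fun D (u n)) ->
  (forall t, D t -> u n t @[n --> \oo] --> f t) ->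
  mu.-integrable D (EFin \o g) ->
  (forall n t, D t -> `|u n t| <= g t) ->
  mu.-integrable D (EFin \o f) /\
  (\int[mu]_(t in D) u n t) @[n --> \oo] --> \int[mu]_(t in D) f t.
Proof.
move=> mD mfn uf gi ug.
have mf : measurable_fun D f by exact: (measurable_fun_cvg mfn uf).
have [| | | | |fi _ h] := @dominated_convergence _ _ _ mu D mD
  (fun n => EFin \o u n) (EFin \o f) (EFin \o g).
- by move=> n; apply/measurable_EFinP; exact: mfn.
- exact/measurable_EFinP.
- by apply: aeW => t Dt; apply: cvg_EFin; [exact: nearW | exact: uf].
- by [].
- by apply: aeW => t n Dt; rewrite /= lee_fin; exact: ug.
split=> //; apply: fine_cvg; rewrite fineK//; exact: integrable_fin_num.
Qed.

Lemma cdominated D (u : nat -> R -> R[i]) f (g : R -> R) : measurable D ->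
  (forall n, cmeasurable D (u n)) -> (forall t, D t -> ccvg (u ^~ t) (f t)) ->
  mu.-integrable D (EFin \o g) -> (forall n t, D t -> normc (u n t) <= g t) ->
  cintegrable D f /\ ccvg (fun n => cintegral D (u n)) (cintegral D f).
Proof.
move=> mD mfn uf gi ug.
have [f1 c1] := @dominated_real D (fun n t => Re (u n t)) (fun t => Re (f t)) g
  mD (fun n => (mfn n).1) (fun t Dt => (uf t Dt).1) gi
  (fun n t Dt => le_trans (normr_Re_le _) (ug n t Dt)).
have [f2 c2] := @dominated_real D (fun n t => Im (u n t)) (fun t => Im (f t)) g
  mD (fun n => (mfn n).2) (fun t Dt => (uf t Dt).2) gi
  (fun n t Dt => le_trans (normr_Im_le _) (ug n t Dt)).
by [].
Qed.

Lemma cFTC_open c d D f F (A B : R[i]) : exhausts c d D ->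
  cintegrable D f -> (forall t, D t -> ccont f t) ->
  (forall t, D t -> is_cderive F t (f t)) ->
  ccvg (fun n => F (c n)) A -> ccvg (fun n => F (d n)) B ->
  cintegral D f = B - A.
Proof.
move=> ex [f1 f2] cf dF [A1 A2] [B1 B2]; apply: complexP.
  rewrite cReD cReN; apply: (@FTC_open _ c d D (fun t => Re (f t)) (fun t => Re (F t)) _ _
    ex f1 _ _ A1 B1).
    by move=> t /set_mem Dt; have [] := cf _ Dt.
  by move=> t Dt; have [] := dF _ Dt.
rewrite cImD cImN; apply: (@FTC_open _ c d D (fun t => Im (f t)) (fun t => Im (F t)) _ _
    ex f2 _ _ A2 B2).
  by move=> t /set_mem Dt; have [] := cf _ Dt.
by move=> t Dt; have [] := dF _ Dt.
Qed.

(** An increasing bijection carries an exhaustion to an exhaustion: this is the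
    form under which the domains of a substitution are compared. *)
Lemma exhausts_comp c d D E (p : R -> R) : exhausts c d D -> is_interval E ->
  (forall s t, D s -> D t -> s < t -> p s < p t) ->
  (forall t, D t -> E (p t)) -> (forall u, E u -> exists2 t, D t & p t = u) ->
  exhausts (p \o c) (p \o d) E.
Proof.
move=> ex iE p_incr DE ED; have [hc hd cd UE] := ex.
have Dc n : D (c n) by apply: (exhausts_sub (n := n) ex); rewrite /= in_itv/= lexx ltW.
have Dd n : D (d n) by apply: (exhausts_sub (n := n) ex); rewrite /= in_itv/= lexx ltW.
have p_nd s t : D s -> D t -> s <= t -> p s <= p t.
  by move=> Ds Dt; rewrite le_eqVlt => /predU1P[->//|st]; exact/ltW/p_incr.
split.
- by move=> m n mn; apply: p_nd => //; exact: hc.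
- by move=> m n mn; apply: p_nd => //; exact: hd.
- by move=> n; exact: p_incr.
apply/seteqP; split=> [u [n _]|u Eu].
  by rewrite /= in_itv/= => un; apply: iE un; exact: DE.
have [t Dt <-] := ED _ Eu.
have [n _ tn] : (\bigcup_n [set` `[c n, d n]]) t by rewrite UE.
exists n => //; move: tn; rewrite /= !in_itv/= => /andP[ct td].
by rewrite !p_nd.
Qed.

Lemma csubstitution c d D E (p p' : R -> R) f : exhausts c d D ->
  exhausts (p \o c) (p \o d) E -> open D -> open E ->
  (forall s t, D s -> D t -> s < t -> p s < p t) ->
  (forall t, D t -> is_derive t (1 : R) p (p' t)) ->
  (forall t, D t -> 0 <= p' t) -> {in D, continuous p'} ->
  (forall u, E u -> ccont f u) -> cintegrable E f ->
  cintegral E f = cintegral D (fun t => f (p t) * (p' t)%:C).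
Proof.
move=> exD exE oD oE p_incr dp p'0 cp' cf [f1 f2]; apply: complexP => /=.
  rewrite (substitution exD exE p_incr dp p'0 cp' oD oE _ f1).
    by apply: eq_Rintegral => t _; rewrite cReMr.
  by move=> t /set_mem Dt; have [] := cf _ Dt.
rewrite (substitution exD exE p_incr dp p'0 cp' oD oE _ f2).
  by apply: eq_Rintegral => t _; rewrite cImMr.
by move=> t /set_mem Dt; have [] := cf _ Dt.
Qed.

Lemma ccvg0 (u : nat -> R[i]) : normc (u n) @[n --> \oo] --> 0 -> ccvg u 0.
Proof.
move=> u0; split; apply/norm_cvg0P; apply: squeeze_cvgr u0; try exact: cvg_cst.
  by apply: nearW => n; rewrite normr_ge0 normr_Re_le.
by apply: nearW => n; rewrite normr_ge0 normr_Im_le.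
Qed.

Lemma ccont_ccvg f t (s : nat -> R) : ccont f t -> s @ \oo --> t ->
  ccvg (fun n => f (s n)) (f t).
Proof.
move=> [f1 f2] st; split.
  exact: (cvg_comp _ _ st f1).
exact: (cvg_comp _ _ st f2).
Qed.

End complex_integral.

(** * Bounded intervals and the half-line *)

Section domains.
Context {R : realType}.
Notation mu := (@lebesgue_measure R).
Implicit Types (x t : R).

Lemma exhausts_unit : exhausts (fun n => n.+3%:R^-1) (fun n => 1 - n.+3%:R^-1)
  [set` `]0, 1[ : interval R].
Proof.
have inv_le m n : (m <= n)%N -> n.+3%:R^-1 <= m.+3%:R^-1 :> R.
  by move=> mn; rewrite lef_pV2 ?posrE// ler_nat.
have inv3 n : n.+3%:R^-1 <= 3^-1 :> R by rewrite lef_pV2 ?posrE// ler_nat.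
have inv_gt0 n : 0 < n.+3%:R^-1 :> R by rewrite invr_gt0.
split.
- by move=> m n /inv_le.
- by move=> m n /inv_le mn; rewrite lerB.
- by move=> n; move: (inv3 n); set u := n.+3%:R^-1; lra.
apply/seteqP; split=> [t [n _]|t]; rewrite /= !in_itv/= => /andP[t0 t1].
  by move: (inv_gt0 n) t0 t1; set u := n.+3%:R^-1; lra.
pose m := Num.truncn (Num.max t^-1 (1 - t)^-1).
have [mt m1t] : t^-1 < m.+3%:R /\ (1 - t)^-1 < m.+3%:R.
  have : Num.max t^-1 (1 - t)^-1 < m.+3%:R.
    rewrite (lt_le_trans (truncnS_gt _))// ler_nat.
    exact: leq_trans (leqnSn _) (leqnSn _).
  by rewrite gt_max => /andP[].
exists m => //; rewrite /= in_itv/=; apply/andP; split.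
  by rewrite -[t in _ <= t]invrK lef_pV2 ?posrE ?invr_gt0// ltW.
rewrite lerBrDr addrC -lerBrDr.
by rewrite -[leRHS]invrK lef_pV2 ?posrE ?invr_gt0 ?subr_gt0// ltW.
Qed.

Lemma exhausts_itv x : 0 < x ->
  exhausts (fun n => x * n.+3%:R^-1) (fun n => x * (1 - n.+3%:R^-1))
    [set` `]0, x[ ].
Proof.
move=> x0; apply: (exhausts_comp (p := fun t => x * t) exhausts_unit).
- exact: interval_is_interval.
- by move=> s t _ _; rewrite ltr_pM2l.
- move=> t; rewrite /= !in_itv/= => /andP[t0 t1].
  by rewrite mulr_gt0//= -[ltRHS]mulr1 ltr_pM2l.
- move=> u; rewrite /= in_itv/= => /andP[u0 ux].
  exists (u / x); last by rewrite mulrCA mulfV ?mulr1// gt_eqF.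
  by rewrite /= in_itv/= divr_gt0//= ltr_pdivrMr// mul1r.
Qed.

Lemma exhausts_itvy : exhausts (fun n => n.+2%:R^-1) (fun n => n.+2%:R)
  [set` `]0, +oo[ : interval R].
Proof.
split.
- by move=> m n mn; rewrite lef_pV2 ?posrE// ler_nat.
- by move=> m n mn; rewrite ler_nat.
- move=> n; rewrite (@lt_trans _ _ 1)// ?ltr1n// invf_lt1// ltr1n//.
apply/seteqP; split=> [t [n _]|t]; rewrite /= !in_itv/= => /andP[t0 t1].
  by rewrite andbT (lt_le_trans _ t0)// invr_gt0.
pose m := Num.truncn (Num.max t^-1 t).
have [mt m1t] : t^-1 < m.+2%:R /\ t < m.+2%:R.
  have : Num.max t^-1 t < m.+2%:R.
    by rewrite (lt_le_trans (truncnS_gt _))// ler_nat leqnSn.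
  by rewrite gt_max => /andP[].
exists m => //; rewrite /= in_itv/= (ltW m1t) andbT.
by rewrite -[t in _ <= t]invrK lef_pV2 ?posrE ?invr_gt0// ltW.
Qed.

Lemma cvg_invS2 (k : nat) : (n + k)%N.+1%:R^-1 @[n --> \oo] --> (0 : R).
Proof.
rewrite -[(fun n => _)]/((fun n => n.+1%:R^-1) \o (fun n => n + k)%N).
exact: (cvg_comp _ _ (cvg_addnr k) (@cvg_harmonic R)).
Qed.

Lemma cvg_lower x : x * n.+3%:R^-1 @[n --> \oo] --> (0 : R).
Proof.
rewrite -(mulr0 x); apply: cvgM; first exact: cvg_cst.
by under eq_cvg do rewrite -addn2; exact: cvg_invS2.
Qed.

Lemma cvg_upper x : x * (1 - n.+3%:R^-1) @[n --> \oo] --> (x : R).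
Proof.
rewrite -[X in _ --> X]mulr1; apply: cvgM; first exact: cvg_cst.
rewrite -[X in _ --> X]subr0; apply: cvgB; first exact: cvg_cst.
by under eq_cvg do rewrite -addn2; exact: cvg_invS2.
Qed.

Lemma powR_cvg0_seq (u : nat -> R) q : 0 < q -> (forall n, 0 < u n) ->
  u @ \oo --> 0 -> u n `^ q @[n --> \oo] --> 0.
Proof.
move=> q0 u0 ucvg; apply: (cvg_comp _ _ _ (powR_cvg0 q0)).
move=> A A0; have {}A0 : \forall t \near nbhs 0, 0 < t -> A t by exact: A0.
change (\forall n \near \oo, A (u n)).
have h : \forall n \near \oo, 0 < u n -> A (u n) by exact: ucvg A0.
by apply: filterS h => n; apply.
Qed.

Lemma powR_cvg_seq (u : nat -> R) x q : 0 < x ->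
  u @ \oo --> x -> u n `^ q @[n --> \oo] --> x `^ q.
Proof.
move=> x0 ux.
exact: (cvg_comp u (fun v => v `^ q) ux (is_derive_continuous (is_derive1_powR q x0))).
Qed.

Lemma lower_gt0 x n : 0 < x -> 0 < x * n.+3%:R^-1.
Proof. by move=> x0; rewrite mulr_gt0. Qed.

Lemma upper_gt0 x n : 0 < x -> 0 < x * (1 - n.+3%:R^-1).
Proof. by move=> x0; rewrite mulr_gt0// subr_gt0 invf_lt1// ltr1n. Qed.

Lemma sub_upper x n : x - x * (1 - n.+3%:R^-1) = x * n.+3%:R^-1.
Proof. by rewrite mulrBr mulr1 opprB addrC subrK. Qed.

Lemma sub_lower x n : x - x * n.+3%:R^-1 = x * (1 - n.+3%:R^-1).
Proof. by rewrite mulrBr mulr1. Qed.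

Lemma integrable_powR x q : 0 < x -> 0 < q ->
  mu.-integrable `]0, x[ (EFin \o (fun t => t `^ (q - 1))).
Proof.
move=> x0 q0.
apply: (ge0_FTC_integrable (exhausts_itv x0) (F := fun t => q^-1 * t `^ q)
  (A := q^-1 * 0) (B := q^-1 * x `^ q)).
- exact: interval_open.
- by move=> t _; exact: powR_ge0.
- move=> t /set_mem; rewrite /= in_itv/= => /andP[t0 _].
  exact: is_derive_continuous (is_derive1_powR (q - 1) t0).
- move=> t; rewrite /= in_itv/= => /andP[t0 _].
  have := @is_deriveZ _ _ _ _ q^-1 t 1 _ (is_derive1_powR q t0).
  by rewrite /GRing.scale/= mulrA mulVf ?gt_eqF// mul1r.
- apply: cvgM; first exact: cvg_cst.
  by apply: powR_cvg0_seq => // [n|]; [exact: lower_gt0 | exact: cvg_lower].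
- apply: cvgM; first exact: cvg_cst.
  by apply: powR_cvg_seq => //; exact: cvg_upper.
Qed.

Lemma integrable_powRB x q : 0 < x -> 0 < q ->
  mu.-integrable `]0, x[ (EFin \o (fun t => (x - t) `^ (q - 1))).
Proof.
move=> x0 q0.
have dpow r t : t < x ->
    is_derive t (1 : R) (fun u => (x - u) `^ r) (r * (x - t) `^ (r - 1) * (- 1)).
  rewrite -subr_gt0 => tx.
  exact: (@is_derive1_comp R (fun v => v `^ r) (fun u => x - u) t _ _
    (is_derive1_powR r tx) (is_derive_subl x t)).
apply: (ge0_FTC_integrable (exhausts_itv x0) (F := fun t => - q^-1 * (x - t) `^ q)
  (A := - q^-1 * x `^ q) (B := - q^-1 * 0)).
- exact: interval_open.
- by move=> t _; exact: powR_ge0.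
- move=> t /set_mem; rewrite /= in_itv/= => /andP[_ tx].
  exact: is_derive_continuous (dpow (q - 1) t tx).
- move=> t; rewrite /= in_itv/= => /andP[_ tx].
  have := @is_deriveZ _ _ _ _ (- q^-1) t 1 _ (dpow q t tx).
  by rewrite /GRing.scale/= mulrN1 mulrNN mulrA mulVf ?gt_eqF// mul1r.
- apply: cvgM; first exact: cvg_cst.
  under eq_cvg do rewrite sub_lower.
  by apply: powR_cvg_seq => //; exact: cvg_upper.
- apply: cvgM; first exact: cvg_cst.
  under eq_cvg do rewrite sub_upper.
  by apply: powR_cvg0_seq => // [n|]; [exact: lower_gt0 | exact: cvg_lower].
Qed.

(** A power is monotone in its base, in a direction depending on the sign of the
    exponent; the sum of the values at the ends covers both cases. *)
Lemma powR_le_ends (a b s r : R) : 0 < a -> a <= s <= b -> s `^ r <= a `^ r + b `^ r.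
Proof.
move=> a0 /andP[as_ sb]; have s0 : 0 < s by exact: lt_le_trans as_.
have b0 : 0 < b by exact: lt_le_trans sb.
have [r0|r0] := leP 0 r.
  rewrite (@le_trans _ _ (b `^ r)) ?lerDr ?powR_ge0//.
  by apply: ge0_ler_powR => //; rewrite nnegrE ltW.
rewrite (@le_trans _ _ (a `^ r)) ?lerDl ?powR_ge0//.
rewrite -[r]opprK powRN [leRHS]powRN lef_pV2 ?posrE ?powR_gt0//.
by apply: ge0_ler_powR => //; rewrite ?nnegrE ?oppr_ge0 ltW.
Qed.

(** Splitting at the midpoint of ]0, x[, each factor is bounded on the half where
    the other one is singular. *)
Lemma integrable_beta x p q : 0 < x -> 0 < p -> 0 < q ->
  mu.-integrable `]0, x[ (EFin \o (fun t => (x - t) `^ (p - 1) * t `^ (q - 1))).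
Proof.
move=> x0 p0 q0; have x20 : 0 < x / 2 by rewrite divr_gt0.
pose C r := (x / 2) `^ (r - 1) + x `^ (r - 1).
have C0 r : 0 <= C r by rewrite addr_ge0 ?powR_ge0.
have mD : measurable (`]0, x[ : set R) by [].
have iC := @integrableD _ _ _ mu `]0, x[ mD _ _
  (integrable_mulE (C p) mD (integrable_powR x0 q0))
  (integrable_mulE (C q) mD (integrable_powRB x0 p0)).
apply: le_integrable iC => //.
  apply/measurable_EFinP; apply: open_continuous_measurable_fun.
    exact: interval_open.
  move=> t /set_mem; rewrite /= in_itv/= => /andP[t0 tx]; apply: cvgM.
    apply: (@continuous_comp _ _ _ (fun t => x - t) (fun u => u `^ (p - 1))).
      by apply: cvgB; [exact: cvg_cst|exact: cvg_id].
    by rewrite -subr_gt0 in tx; exact: is_derive_continuous (is_derive1_powR (p - 1) tx).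
  exact: is_derive_continuous (is_derive1_powR (q - 1) t0).
move=> t; rewrite /= in_itv/= => /andP[t0 tx]; rewrite lee_fin.
have xt0 : 0 < x - t by rewrite subr_gt0.
rewrite ger0_norm ?mulr_ge0 ?powR_ge0// ger0_norm; last first.
  by rewrite addr_ge0// mulr_ge0// powR_ge0.
have [tx2|x2t] := leP t (x / 2).
  rewrite (@le_trans _ _ (C p * t `^ (q - 1)))//; last first.
    by rewrite lerDl mulr_ge0// powR_ge0.
  by rewrite ler_wpM2r ?powR_ge0// powR_le_ends//; apply/andP; split; lra.
rewrite (@le_trans _ _ (C q * (x - t) `^ (p - 1)))//; last first.
  by rewrite lerDr mulr_ge0// powR_ge0.
by rewrite mulrC ler_wpM2r ?powR_ge0// powR_le_ends//; apply/andP; split; lra.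
Qed.

End domains.

(** * The complex beta integral *)

Section beta.
Context {R : realType}.
Notation mu := (@lebesgue_measure R).
Implicit Types (x : R) (a b : R[i]).

Definition beta_integrand x a b (t : R) : R[i] := cpow (x - t) (a - 1) * cpow t (b - 1).
Definition beta x a b : R[i] := cintegral `]0, x[ (beta_integrand x a b).

Lemma cRe_gt0_neq0 (z : R[i]) : 0 < Re z -> z != 0.
Proof. by apply: contraTneq => ->; rewrite ltxx. Qed.

Lemma mem_itvoo x t : [set` `]0, x[ ] t -> 0 < t < x.
Proof. by rewrite /= in_itv. Qed.

Lemma measurable_oo x : measurable (`]0, x[ : set R). Proof. by []. Qed.

Lemma normc_beta x a b t : 0 < t < x ->
  normc (beta_integrand x a b t) = (x - t) `^ (Re a - 1) * t `^ (Re b - 1).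
Proof.
move=> /andP[t0 tx]; rewrite ComplexField.Normc.normcM !normc_cpow ?subr_gt0//.
by rewrite !cReD !cReN.
Qed.

Lemma beta_ccont x a b t : 0 < t < x -> ccont (beta_integrand x a b) t.
Proof.
by move=> /andP[t0 tx]; apply: ccontM; [exact: ccont_cpowB|exact: ccont_cpow].
Qed.

Lemma beta_cmeasurable x a b : cmeasurable `]0, x[ (beta_integrand x a b).
Proof.
apply: ccont_measurable => [|t /mem_itvoo t0x]; first exact: interval_open.
exact: beta_ccont.
Qed.

Lemma beta_cintegrable x a b : 0 < x -> 0 < Re a -> 0 < Re b ->
  cintegrable `]0, x[ (beta_integrand x a b).
Proof.
move=> x0 a0 b0; apply: cintegrable_le (integrable_beta x0 a0 b0) _ => //.
  exact: beta_cmeasurable.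
by move=> t /mem_itvoo t0x; rewrite normc_beta.
Qed.

(** Integration by parts: (x - t)^a t^b vanishes at both ends. *)
Lemma beta_parts x a b : 0 < x -> 0 < Re a -> 0 < Re b ->
  a * beta x a (b + 1) = b * beta x (a + 1) b.
Proof.
move=> x0 a0 b0; have mD := measurable_oo x.
have b10 : 0 < Re (b + 1) by rewrite cReD addr_gt0.
have a10 : 0 < Re (a + 1) by rewrite cReD addr_gt0.
have i1 := beta_cintegrable x0 a0 b10; have i2 := beta_cintegrable x0 a10 b0.
apply/eqP; rewrite -subr_eq0 -opprB oppr_eq0 addrC -mulNr.
rewrite -!cintegralZl// -cintegral_add//; [|exact: cintegrableZl..].
apply/eqP; rewrite -[RHS](subr0 0).
apply: (@cFTC_open _ _ _ _ _ (fun t => cpow (x - t) a * cpow t b) 0 0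
   (exhausts_itv x0)).
- by apply: cintegrable_add => //; exact: cintegrableZl.
- move=> t /mem_itvoo t0x.
  by apply: ccontD; apply: ccontM; try exact: ccont_cst; exact: beta_ccont.
- move=> t /mem_itvoo/andP[t0 tx].
  rewrite (_ : - a * _ + _ = - (a * cpow (x - t) (a - 1)) * cpow t b +
    cpow (x - t) a * (b * cpow t (b - 1))).
    exact: is_cderiveM (is_cderive_cpowB a tx) (is_cderive_cpow b t0).
  by rewrite /beta_integrand !addrK; ring.
- rewrite -(mulr0 (cpow x a)); apply: ccvgM.
    under eq_fun do rewrite sub_lower.
    by apply: (ccont_ccvg (ccont_cpow a x0)); exact: cvg_upper.
  apply: ccvg0; under eq_cvg do rewrite normc_cpow ?lower_gt0//.
  by apply: powR_cvg0_seq => // [n|]; [exact: lower_gt0 | exact: cvg_lower].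
- rewrite -(mul0r (cpow x b)); apply: ccvgM; last first.
    by apply: (ccont_ccvg (ccont_cpow b x0)); exact: cvg_upper.
  apply: ccvg0; under eq_cvg do rewrite sub_upper normc_cpow ?lower_gt0//.
  by apply: powR_cvg0_seq => // [n|]; [exact: lower_gt0 | exact: cvg_lower].
Qed.

(** The factor x = (x - t) + t, put into the integrand. *)
Lemma beta_split x a b : 0 < x -> 0 < Re a -> 0 < Re b ->
  beta x (a + 1) b + beta x a (b + 1) = x%:C * beta x a b.
Proof.
move=> x0 a0 b0; have mD := measurable_oo x.
have b10 : 0 < Re (b + 1) by rewrite cReD addr_gt0.
have a10 : 0 < Re (a + 1) by rewrite cReD addr_gt0.
rewrite -cintegral_add//; [|exact: beta_cintegrable..].
rewrite -cintegralZl//; last exact: beta_cintegrable.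
apply: eq_cintegral => t; rewrite /= in_itv/= => /andP[t0 tx].
rewrite /beta_integrand !addrK -{1}(subrK 1 a) -{2}(subrK 1 b).
rewrite !cpowD !cpow1 ?subr_gt0// rmorphB/=; ring.
Qed.

(** Elimination of [beta x a (b + 1)] between [beta_parts] and [beta_split]. *)
Lemma betaS x a b : 0 < x -> 0 < Re a -> 0 < Re b ->
  (a + b) * beta x (a + 1) b = a * x%:C * beta x a b.
Proof.
move=> x0 a0 b0; rewrite -mulrA -beta_split// mulrDr beta_parts//; ring.
Qed.

Lemma beta1 x b : 0 < x -> 0 < Re b -> b * beta x 1 b = cpow x b.
Proof.
move=> x0 b0; have mD := measurable_oo x.
have i1 := @beta_cintegrable x 1 b x0 ltr01 b0.
rewrite -cintegralZl// -[RHS]subr0.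
apply: (@cFTC_open _ _ _ _ _ (fun t => cpow t b) 0 (cpow x b) (exhausts_itv x0)).
- exact: cintegrableZl.
- move=> t /mem_itvoo t0x.
  by apply: ccontM; [exact: ccont_cst|exact: beta_ccont].
- move=> t /mem_itvoo/andP[t0 tx].
  have := is_cderive_cpow b t0.
  by rewrite /beta_integrand subrr cpow0 mul1r.
- apply: ccvg0; under eq_cvg do rewrite normc_cpow ?lower_gt0//.
  by apply: powR_cvg0_seq => // [n|]; [exact: lower_gt0 | exact: cvg_lower].
- by apply: (ccont_ccvg (ccont_cpow b x0)); exact: cvg_upper.
Qed.

Lemma is_derive_mull x t : is_derive t (1 : R) (fun u => x * u) x.
Proof.
have := @is_deriveZ _ _ _ id x t 1 _ (is_derive_id t 1).
by rewrite /GRing.scale/= mulr1.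
Qed.

(** The substitution of x t for t. *)
Lemma beta_scale x a b : 0 < x -> 0 < Re a -> 0 < Re b ->
  beta x a b = cpow x (a + b - 1) * beta 1 a b.
Proof.
move=> x0 a0 b0.
rewrite -cintegralZl//; last exact: beta_cintegrable.
transitivity (cintegral `]0, 1[ (fun t => beta_integrand x a b (x * t) * x%:C)).
  apply: (@csubstitution R _ _ _ _ (fun t => x * t) (fun=> x) _
    exhausts_unit (exhausts_itv x0)).
  - exact: interval_open.
  - exact: interval_open.
  - by move=> s t _ _; rewrite ltr_pM2l.
  - by move=> t _; exact: is_derive_mull.
  - by move=> t _; exact: ltW.
  - by move=> t _; exact: cvg_cst.
  - by move=> t /mem_itvoo; exact: beta_ccont.
  - exact: beta_cintegrable.
apply: eq_cintegral => t /mem_itvoo/andP[t0 t1].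
rewrite /beta_integrand -[x - x * t](_ : x * (1 - t) = _); last by rewrite mulrBr mulr1.
rewrite !cpowM ?subr_gt0// -(cpow1 x0).
rewrite (_ : a + b - 1 = (a - 1) + (b - 1) + 1); last by ring.
rewrite !cpowD; ring.
Qed.

(** The rising factorial, or Pochhammer symbol. *)
Definition rising (z : R[i]) n : R[i] := \prod_(j < n) (z + j%:R).

Lemma risingSr z n : rising z n.+1 = rising z n * (z + n%:R).
Proof. by rewrite /rising big_ord_recr. Qed.

Lemma risingSl z n : rising z n.+1 = z * rising (z + 1) n.
Proof.
rewrite /rising big_ord_recl addr0; congr (_ * _); apply: eq_bigr => j _.
by rewrite -addrA nat1r.
Qed.

Lemma rising1 n : rising 1 n = n`!%:R.
Proof.
elim: n => [|n IH]; first by rewrite /rising big_ord0.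
by rewrite risingSr IH factS natrM mulrC nat1r.
Qed.

Lemma rising_neq0 z n : 0 < Re z -> rising z n != 0.
Proof.
move=> z0; apply/prodf_neq0 => j _; apply: cRe_gt0_neq0.
by rewrite cReD cRe_nat ltr_wpDr.
Qed.

Lemma beta_rising a b n : 0 < Re a -> 0 < Re b ->
  beta 1 (a + n%:R) b = rising a n / rising (a + b) n * beta 1 a b.
Proof.
move=> a0 b0; have ab0 : 0 < Re (a + b) by rewrite cReD addr_gt0.
elim: n => [|n IH]; first by rewrite addr0 /rising !big_ord0 divr1 mul1r.
have an0 : 0 < Re (a + n%:R) by rewrite cReD cRe_nat ltr_wpDr.
have abn0 : a + b + n%:R != 0.
  by apply: cRe_gt0_neq0; rewrite cReD cRe_nat ltr_wpDr.
rewrite -natr1 addrA; apply: (mulfI abn0).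
have := @betaS 1 (a + n%:R) b ltr01 an0 b0.
rewrite mulr1 IH (addrAC a n%:R b) => ->; rewrite !risingSr.
by field; rewrite abn0 rising_neq0.
Qed.

End beta.

(** * The integrand of the gamma function *)

Section gamma_integral.
Context {R : realType}.
Notation mu := (@lebesgue_measure R).
Implicit Types (x q t : R) (a b z : R[i]).

Lemma mem_itvoy t : [set` `]0, +oo[ ] t -> 0 < t.
Proof. by rewrite /= in_itv/= andbT. Qed.

(** This is ln s <= s - 1 at s = (1 + t) / q. *)
Lemma powR_le_expR q t : 0 < q -> 0 <= t ->
  (1 + t) `^ q <= q `^ q * expR (1 - q) * expR t.
Proof.
move=> q0 t0; have t10 : 0 < 1 + t by rewrite ltr_wpDr.
rewrite /powR !gt_eqF// -!expRD ler_expR.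
have : ln ((1 + t) / q) <= (1 + t) / q - 1.
  rewrite -[in leLHS](subrK 1 ((1 + t) / q)) addrC le_ln1Dx//.
  by rewrite ltrBrDr addNr divr_gt0.
rewrite ln_div ?posrE// -(ler_pM2l q0) mulrBr mulrBr mulrCA mulfV ?gt_eqF//.
lra.
Qed.

(** The function t / (1 + t), in a form that is easy to differentiate: it maps the
    half-line to the unit interval. *)
Definition ratio t : R := 1 - (1 + t)^-1.

Lemma ratioE t : 0 < t -> ratio t = t / (1 + t).
Proof.
by move=> t0; rewrite /ratio; field; rewrite gt_eqF// addr_gt0.
Qed.

Lemma ratio_gt0 t : 0 < t -> 0 < ratio t.
Proof. by move=> t0; rewrite ratioE// divr_gt0// addr_gt0. Qed.

Lemma ratioV t : 0 < t -> ratio t^-1 = (1 + t)^-1.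
Proof.
by move=> t0; rewrite ratioE ?invr_gt0//; field; rewrite !gt_eqF// addr_gt0.
Qed.

Lemma is_derive_ratio t : 0 < t -> is_derive t (1 : R) ratio ((1 + t) ^- 2).
Proof.
move=> t0; have t1 : 1 + t != 0 by rewrite gt_eqF// addr_gt0.
have d1 : is_derive t (1 : R) (fun u => 1 + u) 1.
  rewrite (_ : (fun u => _) = cst 1 + id) //.
  by apply: is_derive_eq; rewrite add0r.
have d2 := @is_deriveV R (fun u => 1 + u) t 1 1 t1 d1.
rewrite (_ : ratio = cst 1 - (fun u => (1 + u)^-1)) //.
apply: is_derive_eq.
by rewrite sub0r /GRing.scale/= mulr1 opprK.
Qed.

(** The bounded primitive (t / (1 + t))^q / q settles both ends of the half-line
    at once. *)
Lemma integrable_ratio q : 0 < q ->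
  mu.-integrable `]0, +oo[ (EFin \o (fun t => ratio t `^ (q - 1) * (1 + t) ^- 2)).
Proof.
move=> q0.
have dF r t : 0 < t -> is_derive t (1 : R) (fun u => ratio u `^ r)
    (r * ratio t `^ (r - 1) * (1 + t) ^- 2).
  move=> t0; exact: (@is_derive1_comp R (fun v => v `^ r) ratio t _ _
    (is_derive1_powR r (ratio_gt0 t0)) (is_derive_ratio t0)).
apply: (ge0_FTC_integrable exhausts_itvy (F := fun t => q^-1 * ratio t `^ q)
  (A := q^-1 * 0) (B := q^-1 * 1 `^ q)).
- exact: interval_open.
- move=> t /mem_itvoy t0; rewrite mulr_ge0 ?powR_ge0// invr_ge0.
  by rewrite exprn_ge0// addr_ge0// ltW.
- move=> t /set_mem/mem_itvoy t0; apply: cvgM.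
    exact: is_derive_continuous (dF (q - 1) t t0).
  have h : {for t, continuous (fun u : R => (1 + u) ^+ 2)}.
    apply: (@continuous_comp _ _ _ (fun u : R => 1 + u) (fun v : R => v ^+ 2)).
      by apply: cvgD; [exact: cvg_cst|exact: cvg_id].
    exact: exprn_continuous.
  by apply: (cvgV _ h); rewrite gt_eqF// exprn_gt0// addr_gt0.
- move=> t /mem_itvoy t0.
  have := @is_deriveZ _ _ _ _ q^-1 t 1 _ (dF q t t0).
  by rewrite /GRing.scale/= !mulrA mulVf ?gt_eqF// mul1r.
- apply: cvgM; first exact: cvg_cst.
  apply: powR_cvg0_seq => // [n|]; first by apply: ratio_gt0; rewrite invr_gt0.
  under eq_cvg do rewrite ratioV// nat1r -addn2.
  exact: cvg_invS2.
- apply: cvgM; first exact: cvg_cst.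
  apply: powR_cvg_seq => //; rewrite -[X in _ --> X]subr0.
  apply: cvgB; first exact: cvg_cst.
  by under eq_cvg do rewrite nat1r -addn2; exact: cvg_invS2.
Qed.

Lemma expR_cont t : {for t, continuous (fun u : R => expR (- u))}.
Proof.
apply: continuous_comp; last exact: continuous_expR.
exact: opp_continuous.
Qed.

(** The exponential decays faster than the power (1 + t)^(- (q + 1)), so the
    integrand of [integrable_ratio] is a majorant up to a constant. *)
Lemma integrable_gamma q : 0 < q ->
  mu.-integrable `]0, +oo[ (EFin \o (fun t => t `^ (q - 1) * expR (- t))).
Proof.
move=> q0; have q10 : 0 < q + 1 by rewrite addr_gt0.
have mD : measurable (`]0, +oo[ : set R) by [].
pose C := (q + 1) `^ (q + 1) * expR (1 - (q + 1)).
have C0 : 0 <= C by rewrite mulr_ge0 ?powR_ge0 ?expR_ge0.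
apply: le_integrable (integrable_mulE C mD (integrable_ratio q0)) => //.
  apply/measurable_EFinP; apply: open_continuous_measurable_fun.
    exact: interval_open.
  move=> t /set_mem/mem_itvoy t0; apply: cvgM; last exact: expR_cont.
  exact: is_derive_continuous (is_derive1_powR (q - 1) t0).
move=> t /mem_itvoy t0; rewrite lee_fin.
have t10 : 0 < 1 + t by rewrite addr_gt0.
rewrite ger0_norm ?mulr_ge0 ?powR_ge0 ?expR_ge0//.
apply: le_trans (ler_norm _).
have -> : ratio t `^ (q - 1) * (1 + t) ^- 2 = t `^ (q - 1) * (1 + t) `^ (- (q + 1)).
  rewrite ratioE// powRM ?invr_ge0 ?(ltW t0) ?(ltW t10)// -mulrA; congr (_ * _).
  rewrite -(powR_inv1 (ltW t10)) -powRrM -(powR_invn 2 (ltW t10)).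
  rewrite -powRD ?(gt_eqF t10) ?implybT//.
  by congr (_ `^ _); ring.
rewrite mulrCA ler_wpM2l ?powR_ge0//.
rewrite powRN ler_pdivlMr ?powR_gt0// expRN mulrC ler_pdivrMr ?expR_gt0//.
by rewrite powR_le_expR// ltW.
Qed.

Definition gamma_integrand z t : R[i] := cpow t (z - 1) * (expR (- t))%:C.

Lemma normc_gamma z t : 0 < t ->
  normc (gamma_integrand z t) = t `^ (Re z - 1) * expR (- t).
Proof.
move=> t0; rewrite ComplexField.Normc.normcM normc_cpow// cReD cReN normc_real.
by rewrite (ger0_norm (expR_ge0 _)).
Qed.

Lemma gamma_ccont z t : 0 < t -> ccont (gamma_integrand z) t.
Proof.
move=> t0; apply: ccontM; first exact: ccont_cpow.
by split; [exact: expR_cont | exact: cvg_cst].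
Qed.

Lemma gamma_cintegrable z : 0 < Re z -> cintegrable `]0, +oo[ (gamma_integrand z).
Proof.
move=> z0; apply: cintegrable_le (integrable_gamma z0) _ => //.
  apply: ccont_measurable; first exact: interval_open.
  by move=> t /mem_itvoy; exact: gamma_ccont.
by move=> t /mem_itvoy t0; rewrite normc_gamma.
Qed.

Lemma onem_exprn_le (N : nat) t : 0 < t < N%:R -> (1 - t / N%:R) ^+ N <= expR (- t).
Proof.
move=> /andP[t0 tN]; have N0 : 0 < N%:R :> R by exact: lt_trans tN.
rewrite (_ : - t = N%:R * - (t / N%:R)); last first.
  by rewrite mulrN mulrCA mulfV ?mulr1// gt_eqF.
rewrite expRM_natl lerXn2r ?nnegrE ?expR_ge0//.
  by rewrite subr_ge0 ler_pdivrMr// mul1r ltW.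
by rewrite expR_ge1Dx.
Qed.

(** With s = t / N, this is 1 / (1 - s) = 1 + s / (1 - s) <= exp (s / (1 - s)). *)
Lemma onem_exprn_ge (N : nat) t : 0 < t < N%:R ->
  expR (- (t / (1 - t / N%:R))) <= (1 - t / N%:R) ^+ N.
Proof.
move=> /andP[t0 tN]; have N0 : 0 < N%:R :> R by exact: lt_trans tN.
have s0 : 0 < 1 - t / N%:R by rewrite subr_gt0 ltr_pdivrMr// mul1r.
rewrite (_ : - _ = N%:R * - (t / N%:R / (1 - t / N%:R))); last first.
  by rewrite mulrN; congr (- _); field; rewrite !gt_eqF// subr_gt0.
rewrite expRM_natl lerXn2r ?nnegrE ?expR_ge0 ?(ltW s0)//.
rewrite expRN invf_ple ?posrE ?expR_gt0//.
rewrite (le_trans _ (expR_ge1Dx _))// le_eqVlt; apply/orP; left; apply/eqP.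
by field; rewrite !gt_eqF// subr_gt0.
Qed.

Lemma cvg_over_nat t : t / n.+1%:R @[n --> \oo] --> (0 : R).
Proof.
rewrite -(mulr0 t); apply: cvgM; [exact: cvg_cst|exact: cvg_harmonic].
Qed.

Lemma near_lt_nat t : \forall n \near \oo, t < n.+1%:R.
Proof.
near=> n; rewrite (lt_le_trans (truncnS_gt t))// ler_nat ltnS.
by near: n; exact: nbhs_infty_ge.
Unshelve. all: by end_near. Qed.

Lemma cvg_onem_exprn t : 0 < t ->
  (1 - t / n.+1%:R) ^+ n.+1 @[n --> \oo] --> expR (- t).
Proof.
move=> t0.
have lo : expR (- (t / (1 - t / n.+1%:R))) @[n --> \oo] --> expR (- t).
  have h : t / (1 - t / n.+1%:R) @[n --> \oo] --> t.
    rewrite -[X in _ --> X]mulr1; apply: cvgM; first exact: cvg_cst.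
    rewrite -[X in _ --> X]invr1; apply: cvgV; first exact: oner_neq0.
    rewrite -[X in _ --> X]subr0; apply: cvgB; first exact: cvg_cst.
    exact: cvg_over_nat.
  exact: (cvg_comp _ (fun u => expR (- u)) h (@expR_cont t)).
apply: squeeze_cvgr lo (cvg_cst (expR (- t))).
apply: filterS (near_lt_nat t) => n tn.
by rewrite onem_exprn_ge ?onem_exprn_le// t0.
Qed.

End gamma_integral.

(** * The limit formula of Gauss and its consequences *)

Section gauss.
Context {R : realType}.
Notation mu := (@lebesgue_measure R).
Implicit Types (x t : R) (a b z : R[i]).

Lemma cintegral_patch (D E : set R) (f : R -> R[i]) : E `<=` D ->
  cintegral E f = cintegral D (fun t => if t \in E then f t else 0).
Proof.
move=> ED; have -> : E = D `&` E by rewrite setIidr.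
rewrite /cintegral !Rintegral_mkcondr; congr (_ +i* _);
  by apply: eq_Rintegral => t tD; rewrite patchE in_setI tD /=; case: ifP.
Qed.

Lemma cmeasurable_patch (D E : set R) (f : R -> R[i]) : measurable D -> measurable E ->
  E `<=` D -> cmeasurable E f -> cmeasurable D (fun t => if t \in E then f t else 0).
Proof.
move=> mD mE ED [f1 f2].
have DE : D `&` E = E by rewrite setIidr.
split.
  rewrite (_ : (fun t => _) = (fun t => Re (f t)) \_ E).
    by apply/(measurable_restrict _ mE mD); rewrite DE.
  by apply/funext => t; rewrite patchE; case: ifP.
rewrite (_ : (fun t => _) = (fun t => Im (f t)) \_ E).
  by apply/(measurable_restrict _ mE mD); rewrite DE.
by apply/funext => t; rewrite patchE; case: ifP.
Qed.

Lemma ccvg_real (u : nat -> R) (l : R) : u @ \oo --> l -> ccvg (fun n => (u n)%:C) l%:C.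
Proof. by move=> ul; split => //; exact: cvg_cst. Qed.

(** After rescaling to ]0, N[ with N = n + 1, the integrand of the left-hand side
    is (1 - t / N)^(a + N) t^(b - 1): it tends to exp (- t) t^(b - 1), and
    (1 - t / N)^N <= exp (- t) provides a majorant. The case a = 0 is the limit
    formula of Gauss; the general case brings in the beta function. *)
Lemma gauss_beta a b : 0 <= Re a -> 0 < Re b ->
  ccvg (fun n => cpow n.+1%:R b * beta 1 (a + n.+2%:R) b) (Gamma_integral b).
Proof.
move=> a0 b0.
have subD (n : nat) : `]0, n.+1%:R[ `<=` (`]0, +oo[ : set R).
  by move=> t; rewrite /= !in_itv/= => /andP[->].
have mD : measurable (`]0, +oo[ : set R) by [].
pose g n t := cpow (1 - t / n.+1%:R) (a + n.+1%:R) * cpow t (b - 1).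
pose u n t := if t \in [set` `]0, n.+1%:R[ ] then g n t else 0.
have uE n : cpow n.+1%:R b * beta 1 (a + n.+2%:R) b = cintegral `]0, +oo[ (u n).
  have N0 : 0 < n.+1%:R :> R by [].
  have an0 : 0 < Re (a + n.+2%:R) by rewrite cReD cRe_nat ltr_wpDl.
  rewrite -(cintegral_patch _ (subD n)).
  have -> : beta 1 (a + n.+2%:R) b =
      cpow n.+1%:R (- (a + n.+2%:R + b - 1)) * beta n.+1%:R (a + n.+2%:R) b.
    by rewrite (beta_scale N0 an0 b0) mulrA -cpowD addNr cpow0 mul1r.
  rewrite mulrA -cpowD (_ : b + _ = - (a + n.+1%:R)); last first.
    by rewrite -[in n.+2%:R]natr1; ring.
  rewrite /beta -cintegralZl//; last exact: beta_cintegrable.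
  apply: eq_cintegral => t /mem_itvoo/andP[t0 tn].
  rewrite /beta_integrand /g mulrA; congr (_ * _).
  have -> : 1 - t / n.+1%:R = (n.+1%:R - t) / n.+1%:R by field; rewrite gt_eqF.
  rewrite cpowM ?subr_gt0 ?invr_gt0// cpowV// -cpowN mulrC.
  by congr (cpow _ _ * _); rewrite -[in n.+2%:R]natr1; ring.
have g_meas n : cmeasurable `]0, n.+1%:R[ (g n).
  apply: ccont_measurable; first exact: interval_open.
  move=> t /mem_itvoo/andP[t0 tn].
  have N0 : 0 < n.+1%:R :> R by [].
  apply: ccontM; last exact: ccont_cpow.
  apply: is_cderive_ccont.
  have d1 : is_derive t (1 : R) (fun v => 1 - v / n.+1%:R) (- n.+1%:R^-1).
    have := is_derive_mull n.+1%:R^-1 t.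
    move=> d2.
    rewrite (_ : (fun v => _) = cst 1 - (fun v => n.+1%:R^-1 * v)); last first.
      by apply/funext => v; rewrite [v / _]mulrC.
    by apply: is_derive_eq; rewrite sub0r.
  have s0 : 0 < 1 - t / n.+1%:R by rewrite subr_gt0 ltr_pdivrMr// mul1r.
  exact: (is_cderive_cexp (a + n.+1%:R)
    (@is_derive1_comp R (@ln R) (fun v => 1 - v / n.+1%:R) t _ _ (is_derive1_ln s0) d1)).
have [] := @cdominated R `]0, +oo[ u (gamma_integrand b)
  (fun t => t `^ (Re b - 1) * expR (- t)) mD.
- by move=> n; apply: cmeasurable_patch.
- move=> t /mem_itvoy t0.
  apply: (@ccvg_eq _ (fun n => cpow (1 - t / n.+1%:R) a *
      ((1 - t / n.+1%:R) ^+ n.+1)%:C * cpow t (b - 1))).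
    apply: filterS (near_lt_nat t) => n tn.
    rewrite /u mem_set; last by rewrite /= in_itv/= t0.
    rewrite /g [cpow _ (a + _)]cpowD.
    rewrite (@cpow_nat _ (1 - t / n.+1%:R)); first by rewrite rmorphXn.
    by rewrite subr_gt0 ltr_pdivrMr// mul1r.
  rewrite /gamma_integrand mulrC -[X in ccvg _ (X * _)]mul1r.
  apply: ccvgM; last exact: ccvg_cst.
  apply: ccvgM; last by apply: ccvg_real; exact: cvg_onem_exprn.
  rewrite -(cpow1l a); apply: (ccont_ccvg (ccont_cpow a ltr01)).
  rewrite -[X in _ --> X]subr0; apply: cvgB; first exact: cvg_cst.
  exact: cvg_over_nat.
- exact: integrable_gamma.
- move=> n t /mem_itvoy t0; rewrite /u; case: ifPn => [/set_mem/mem_itvoo/andP[_ tn]|_].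
    have s0 : 0 < 1 - t / n.+1%:R by rewrite subr_gt0 ltr_pdivrMr// mul1r.
    have s1 : 1 - t / n.+1%:R <= 1 by rewrite lerBlDr lerDl divr_ge0// ltW.
    rewrite ComplexField.Normc.normcM !normc_cpow// !cReD cReN cRe_nat/=.
    rewrite mulrC ler_wpM2l ?powR_ge0//.
    rewrite powRD ?(gt_eqF s0) ?implybT// powR_mulrn ?(ltW s0)// -[leRHS]mul1r.
    rewrite ler_pM ?powR_ge0 ?exprn_ge0 ?(ltW s0)//.
      rewrite -[leRHS](powRr0 (1 - t / n.+1%:R)).
      by apply: ger_powR => //; rewrite s0.
    by rewrite onem_exprn_le// t0.
  by rewrite ComplexField.Normc.normc0 mulr_ge0 ?powR_ge0 ?expR_ge0.
- by move=> _ h; apply: ccvg_eq h; apply: nearW => n; rewrite uE.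
Qed.

(** The quotient N^z N! / (z (z + 1) ... (z + N)) of Gauss, for N = n + 1. *)
Definition gauss n z : R[i] := cpow n.+1%:R z * n.+1`!%:R / rising z n.+2.

Lemma gauss_cvg z : 0 < Re z -> ccvg (gauss ^~ z) (Gamma_integral z).
Proof.
move=> z0; have := @gauss_beta 0 z (lexx _) z0.
apply: ccvg_eq; apply: nearW => n; rewrite /gauss -mulrA; congr (_ * _).
rewrite add0r -nat1r (@beta_rising _ 1 z n.+1 ltr01 z0) rising1 (risingSl z) [1 + z]addrC.
apply: (mulfI (cRe_gt0_neq0 z0)).
have r0 : rising (z + 1) n.+1 != 0 by rewrite rising_neq0// cReD addr_gt0.
rewrite mulrCA beta1// cpow1l; field.
by rewrite r0 cRe_gt0_neq0.
Qed.

(** By [beta_rising], the product of the quotient of Gauss at a with the sequence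
    of [gauss_beta] is B(a, b) times the quotient at a + b, since the rising
    factorials of a cancel; the two limits of that product are equated. *)
Lemma beta_gamma a b : 0 < Re a -> 0 < Re b ->
  beta 1 a b * Gamma_integral (a + b) = Gamma_integral a * Gamma_integral b.
Proof.
move=> a0 b0; have ab0 : 0 < Re (a + b) by rewrite cReD addr_gt0.
have h1 := ccvgM (gauss_cvg a0) (gauss_beta (ltW a0) b0).
have h2 := ccvgM (ccvg_cst (beta 1 a b)) (gauss_cvg ab0).
apply: (ccvg_unique h2); apply: ccvg_eq h1; apply: nearW => n.
rewrite beta_rising// /gauss cpowD; field.
by rewrite !rising_neq0.
Qed.

Lemma Gamma_integral1 : Gamma_integral 1 = 1 :> R[i].
Proof.
apply: (ccvg_unique (gauss_cvg (z := 1) ltr01)).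
apply: (@ccvg_eq _ (fun n => (1 - n.+2%:R^-1)%:C)).
  apply: nearW => n; rewrite /gauss cpow1// rising1.
  rewrite [n.+2`!]factS natrM rmorphB rmorph1/= fmorphV/= !rmorph_nat.
  have f0 : n.+1`!%:R != 0 :> R[i] by rewrite pnatr_eq0 -lt0n fact_gt0.
  have n0 : n.+2%:R != 0 :> R[i] by rewrite pnatr_eq0.
  rewrite -[n.+1%:R](addrK 1) natr1.
  move: (n.+1`!%:R) (n.+2%:R) f0 n0 => f M f0 n0.
  by field; rewrite f0 n0.
apply: ccvg_real; rewrite -[X in _ --> X]subr0; apply: cvgB; first exact: cvg_cst.
by under eq_cvg do rewrite -addn1; exact: cvg_invS2.
Qed.

(** The case a = 1 of [beta_gamma], where z B(1, z) = 1. *)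
Lemma Gamma_integralS z : 0 < Re z -> Gamma_integral (z + 1) = z * Gamma_integral z.
Proof.
move=> z0; have := @beta_gamma 1 z ltr01 z0.
rewrite Gamma_integral1 mul1r [1 + z]addrC => h.
by rewrite -h mulrA beta1// cpow1l mul1r.
Qed.

(** With N = n + 1 and z = x + i y, the ratio of consecutive quotients of Gauss has
    modulus ((N + 1) / N)^x (N + 1) / |z + N + 1|. Here
    ((N + 1) / N)^x >= 1 + x / (N + 1), and |z + N + 1| exceeds x + N + 1 by a factor
    of at most 1 + y^2 / (x + N + 1)^2, whose logarithm is at most
    y^2 / (N (N + 1)). *)
Lemma gauss_step n z : 0 < Re z ->
  normc (gauss n z) * expR (- (Im z ^+ 2 * (n.+1%:R^-1 - n.+2%:R^-1)))
    <= normc (gauss n.+1 z).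
Proof.
move=> z0; set N : R := n.+1%:R; have N0 : 0 < N by [].
have ME : n.+2%:R = N + 1 by rewrite natr1.
have M0 : 0 < N + 1 by rewrite addr_gt0.
have gE : gauss n.+1 z = gauss n z * (cpow ((N + 1) / N) z * ((N + 1)%:C / (z + n.+2%:R))).
  rewrite /gauss risingSr factS natrM cpowM ?invr_gt0// cpowV// -ME.
  rewrite -natC -/N.
  have zM : z + n.+2%:R != 0 by rewrite cRe_gt0_neq0// cReD cRe_nat ltr_wpDr.
  move: (rising_neq0 n.+2 z0) zM (cpow_neq0 N z).
  move: (rising z n.+2) (z + n.+2%:R) (cpow N z) (cpow n.+2%:R z) => r w p q r0 w0 p0.
  move: (n.+2%:R : R[i]) (n.+1`!%:R : R[i]) => M f.
  by field; rewrite r0 w0 p0.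
rewrite gE [leRHS]ComplexField.Normc.normcM ler_wpM2l ?normc_ge0//.
rewrite ComplexField.Normc.normcM normc_cpow ?divr_gt0//.
rewrite ComplexField.Normc.normcM ComplexField.Normc.normcV normc_real gtr0_norm//.
set x := Re z; set y := Im z.
have xM0 : 0 < x + (N + 1) by rewrite addr_gt0.
have normz : normc (z + n.+2%:R) <= (x + (N + 1)) * expR (y ^+ 2 * (N^-1 - (N + 1)^-1)).
  have le1 : normc (z + n.+2%:R) <= (x + (N + 1)) * (1 + y ^+ 2 / (x + (N + 1)) ^+ 2).
    rewrite -[leRHS]ger0_norm; last first.
      by rewrite mulr_ge0 ?(ltW xM0)// addr_ge0// divr_ge0 ?sqr_ge0.
    rewrite -sqrtr_sqr.
    have -> : normc (z + n.+2%:R) = Num.sqrt ((x + (N + 1)) ^+ 2 + y ^+ 2).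
      rewrite (complexE z) natC -ME /=.
      by rewrite /x /y; case: (z) => p q /=; rewrite !(mul0r, mulr0, mul1r, subr0, addr0, add0r).
    rewrite ler_wsqrtr//; move: (x + (N + 1)) xM0 => s s0.
    have -> : (s * (1 + y ^+ 2 / s ^+ 2)) ^+ 2 = s ^+ 2 + y ^+ 2 + (y ^+ 2 + (y ^+ 2 / s) ^+ 2).
      by field; rewrite gt_eqF.
    by rewrite lerDl addr_ge0 ?sqr_ge0.
  rewrite (le_trans le1)// ler_pM2l// (le_trans (expR_ge1Dx _))// ler_expR.
  rewrite ler_wpM2l ?sqr_ge0//.
  have -> : N^-1 - (N + 1)^-1 = (N * (N + 1))^-1 by field; rewrite !gt_eqF.
  rewrite lef_pV2 ?posrE ?mulr_gt0 ?exprn_gt0//.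
  by rewrite expr2 ler_pM ?(ltW N0) ?(ltW M0)// /N; have := ltW z0; rewrite -/x; lra.
have pow_ge : 1 + x / (N + 1) <= ((N + 1) / N) `^ x.
  rewrite (le_trans (expR_ge1Dx _))// /powR gt_eqF ?divr_gt0// ler_expR.
  rewrite ler_pM2l// -[X in ln X]invrK lnV ?posrE ?invr_gt0 ?divr_gt0//.
  rewrite lerNr (_ : ((N + 1) / N)^-1 = 1 + - (N + 1)^-1); last by field; rewrite !gt_eqF.
  by rewrite le_ln1Dx// ltrN2 invf_lt1// ltrDr.
have nz0 : 0 < normc (z + n.+2%:R).
  rewrite lt_neqAle normc_ge0 eq_sym normc_eq0 andbT cRe_gt0_neq0//.
  by rewrite cReD cRe_nat ltr_wpDr.
rewrite -ME -/N in normz pow_ge *.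
rewrite expRN mulrA ler_pdivlMr// mulrC ler_pdivrMr ?expR_gt0//.
rewrite ME in normz pow_ge *.
rewrite (le_trans normz)// ler_wpM2r ?expR_ge0//.
rewrite (_ : x + (N + 1) = (1 + x / (N + 1)) * (N + 1)); last by field; rewrite gt_eqF.
by rewrite ler_wpM2r// ltW.
Qed.

(** The bounds of [gauss_step] telescope. *)
Lemma gauss_lower n z : 0 < Re z ->
  normc (gauss 0 z) * expR (- (Im z ^+ 2 * (1 - n.+1%:R^-1))) <= normc (gauss n z).
Proof.
move=> z0; elim: n => [|n IH]; first by rewrite invr1 subrr mulr0 oppr0 expR0 mulr1.
apply: le_trans (gauss_step n z0).
have -> : - (Im z ^+ 2 * (1 - n.+2%:R^-1)) = - (Im z ^+ 2 * (1 - n.+1%:R^-1)) +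
   - (Im z ^+ 2 * (n.+1%:R^-1 - n.+2%:R^-1)) by ring.
by rewrite expRD mulrA ler_wpM2r ?expR_ge0.
Qed.

(** By [gauss_lower] the quotients of Gauss are bounded away from 0. *)
Lemma Gamma_integral_neq0 z : 0 < Re z -> Gamma_integral z != 0.
Proof.
move=> z0; apply/eqP => G0; have [h1 h2] := gauss_cvg z0.
rewrite G0 in h1 h2.
have g0 : 0 < normc (gauss 0 z) * expR (- (Im z ^+ 2)).
  rewrite mulr_gt0 ?expR_gt0// lt_neqAle normc_ge0 eq_sym normc_eq0 andbT.
  by rewrite mulf_neq0 ?invr_eq0 ?rising_neq0// mulf_neq0 ?cpow_neq0// pnatr_eq0.
have h : `|Re (gauss n z)| + `|Im (gauss n z)| @[n --> \oo] --> (0 : R).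
  rewrite -(addr0 0); by apply: cvgD; apply/norm_cvg0P.
move/cvgr_lt : h => /(_ _ g0) [N _ /(_ N (leqnn N))] /=.
apply/negP; rewrite -leNgt.
apply: le_trans (normc_le _); apply: le_trans (gauss_lower N z0).
rewrite ler_wpM2l ?normc_ge0// ler_expR lerN2 -[leRHS]mulr1 ler_wpM2l ?sqr_ge0//.
Qed.

End gauss.

(** * The functions Gamma and Gammak *)

Section gammak.
Context {R : realType}.
Implicit Types (k x t : R) (z w : R[i]).

Lemma Gamma_gt0 z : 0 < Re z -> Gamma z = Gamma_integral z.
Proof. by move=> z0; rewrite /Gamma z0. Qed.

Lemma GammaS z : 0 < Re z -> Gamma (z + 1) = z * Gamma z.
Proof.
by move=> z0; rewrite !Gamma_gt0 ?Gamma_integralS// cReD addr_gt0.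
Qed.

Lemma Gamma_neq0 z : 0 < Re z -> Gamma z != 0.
Proof. by move=> z0; rewrite Gamma_gt0// Gamma_integral_neq0. Qed.

Lemma betaE x a b : 0 < x -> 0 < Re a -> 0 < Re b ->
  beta x a b = cpow x (a + b - 1) * (Gamma a * Gamma b / Gamma (a + b)).
Proof.
move=> x0 a0 b0; have ab0 : 0 < Re (a + b) by rewrite cReD addr_gt0.
rewrite beta_scale//; congr (_ * _).
by rewrite !Gamma_gt0// -beta_gamma// mulfK// Gamma_integral_neq0.
Qed.

Lemma cRe_div z k : Re (z / k%:C) = Re z / k.
Proof. by rewrite -fmorphV cReMr. Qed.

(** The substitution u = t^k / k in the integral defining [Gamma]. *)
Lemma GammakE k z : 0 < k -> Gammak k z = cpow k (z / k%:C - 1) * Gamma (z / k%:C).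
Proof.
move=> k0; rewrite /Gammak; case: ifPn => // z0.
set w := z / k%:C; have w0 : 0 < Re w by rewrite cRe_div divr_gt0.
have kC0 : k%:C != 0 by rewrite fmorph_eq0 gt_eqF.
rewrite Gamma_gt0// -[Gamma_integral w]/(cintegral `]0, +oo[ (gamma_integrand w)).
rewrite -cintegralZl//; last exact: gamma_cintegrable.
pose p t := k^-1 * t `^ k; pose p' t := t `^ (k - 1).
have p_incr s t : 0 < s -> 0 < t -> s < t -> p s < p t.
  move=> s0 t0 st; rewrite /p ltr_pM2l ?invr_gt0//.
  by apply: gt0_ltr_powR => //; rewrite nnegrE ltW.
have p_gt0 t : 0 < t -> 0 < p t by move=> t0; rewrite mulr_gt0 ?invr_gt0 ?powR_gt0.
have exE : exhausts (p \o (fun n => n.+2%:R^-1)) (p \o (fun n => n.+2%:R))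
    [set` `]0, +oo[ : interval R].
  apply: (exhausts_comp exhausts_itvy).
  - exact: interval_is_interval.
  - by move=> s t /mem_itvoy s0 /mem_itvoy t0; exact: p_incr.
  - by move=> t /mem_itvoy /p_gt0; rewrite /= in_itv/= andbT.
  - move=> u /mem_itvoy u0; exists ((k * u) `^ k^-1).
      by rewrite /= in_itv/= andbT powR_gt0// mulr_gt0.
    rewrite /p -powRrM mulVf ?gt_eqF// powRr1 ?mulr_ge0 ?ltW//.
    by rewrite mulrA mulVf ?mul1r// gt_eqF.
have dp t : 0 < t -> is_derive t (1 : R) p (p' t).
  move=> t0; have := @is_deriveZ _ _ _ _ k^-1 t 1 _ (is_derive1_powR k t0).
  by rewrite /GRing.scale/= mulrA mulVf ?gt_eqF// mul1r.
apply/esym.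
transitivity (cintegral `]0, +oo[
    (fun t => cpow k (w - 1) * gamma_integrand w (p t) * (p' t)%:C)).
  apply: (@csubstitution R _ _ _ _ p p'
    (fun u => cpow k (w - 1) * gamma_integrand w u) exhausts_itvy exE).
  - exact: interval_open.
  - exact: interval_open.
  - by move=> s t /mem_itvoy s0 /mem_itvoy t0; exact: p_incr.
  - by move=> t /mem_itvoy; exact: dp.
  - by move=> t _; exact: powR_ge0.
  - move=> t /set_mem/mem_itvoy t0.
    exact: is_derive_continuous (is_derive1_powR (k - 1) t0).
  - move=> t /mem_itvoy t0; apply: ccontM; first exact: ccont_cst.
    exact: gamma_ccont.
  - by apply: cintegrableZl => //; exact: gamma_cintegrable.
apply: eq_cintegral => t /mem_itvoy t0.
rewrite /gamma_integrand [p t]mulrC -/(t `^ k / k).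
rewrite cpowM ?invr_gt0 ?powR_gt0// cpowV// cpow_powR.
rewrite -(cpow_real (k - 1) t0).
have -> : cpow t (z - 1) = cpow t (k%:C * (w - 1)) * cpow t (k - 1)%:C.
  rewrite -cpowD; congr cpow; rewrite /w rmorphB rmorph1/=; field.
  exact: kC0.
move: (cpow_neq0 k (w - 1)) => c0; field.
exact: c0.
Qed.

(** By the functional equation the sequence is nonincreasing as soon as
    Re (w + n) >= 1. Before that, finitely many terms have to be covered, among
    them those at the poles, whose value is 0. *)
Lemma invGamma_bounded w : exists2 C : R, 0 <= C &
  forall n, normc (Gamma (w + n%:R))^-1 <= C.
Proof.
pose N := (Num.truncn (1 - Re w)).+1.
have N1 : 1 <= Re w + N%:R.
  by rewrite -lerBlDl ltW// truncnS_gt.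
have ge_N m : normc (Gamma (w + (N + m)%:R))^-1 <= normc (Gamma (w + N%:R))^-1.
  elim: m => [|m IH]; first by rewrite addn0.
  apply: le_trans IH; rewrite addnS -natr1 addrA.
  have ge1 : 1 <= Re (w + (N + m)%:R).
    by rewrite cReD cRe_nat (le_trans N1)// lerD2l ler_nat leq_addr.
  rewrite GammaS ?(lt_le_trans ltr01)// invfM ComplexField.Normc.normcM.
  rewrite mulrC ler_piMr ?normc_ge0// ComplexField.Normc.normcV.
  have norm_ge1 : 1 <= normc (w + (N + m)%:R).
    by rewrite (le_trans ge1)// (le_trans (ler_norm _))// normr_Re_le.
  by rewrite invf_le1// (lt_le_trans ltr01).
exists (\sum_(j < N.+1) normc (Gamma (w + j%:R))^-1).
  by apply: sumr_ge0 => j _; exact: normc_ge0.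
move=> n; have [nN|Nn] := leqP n N.
  rewrite (bigD1 (Ordinal (nN : (n < N.+1)%N)))//= lerDl.
  by apply: sumr_ge0 => j _; exact: normc_ge0.
rewrite -(subnKC (ltnW Nn)) (le_trans (ge_N _))//.
rewrite big_ord_recr/= lerDr.
by apply: sumr_ge0 => j _; exact: normc_ge0.
Qed.

End gammak.

(** * Series dominated by an exponential series *)

Section series.
Context {R : realType}.
Implicit Types (r M t x : R) (v : nat -> R[i]).

Lemma sum_exp_coeff_le r n : 0 <= r -> \sum_(0 <= j < n) r ^+ j / j`!%:R <= expR r.
Proof.
move=> r0; apply: (@nondecreasing_cvgn_le _ (series (exp_coeff r))).
  apply/nondecreasing_seqP => m; rewrite /series /= big_nat_recr//= lerDl.
  exact: exp_coeff_ge0.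
exact: is_cvg_series_exp_coeff.
Qed.

Lemma real_series_cvg (v : nat -> R) M r : 0 <= r ->
  (forall n, `|v n| <= M * (r ^+ n / n`!%:R)) -> cvgn (series v).
Proof.
move=> r0 vM; apply: normed_cvg.
apply: (@series_le_cvg _ _ (fun n => M * (r ^+ n / n`!%:R))) => //.
- by move=> n; exact: normr_ge0.
- by move=> n; exact: le_trans (vM n).
- have -> : (fun n => M * (r ^+ n / n`!%:R)) = M *: exp_coeff r by [].
  exact: (@is_cvg_seriesZ _ _ M (is_cvg_series_exp_coeff r)).
Qed.

Lemma cRe_series v n : Re (series v n) = series (fun j => Re (v j)) n.
Proof. exact: cRe_sum. Qed.
Lemma cIm_series v n : Im (series v n) = series (fun j => Im (v j)) n.
Proof. exact: cIm_sum. Qed.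

Lemma ccvg_series v M r : 0 <= r ->
  (forall n, normc (v n) <= M * (r ^+ n / n`!%:R)) -> ccvg (series v) (csum v).
Proof.
move=> r0 vM.
have c1 : cvgn (series (fun j => Re (v j))).
  by apply: (real_series_cvg r0) => n; exact: le_trans (normr_Re_le _) (vM n).
have c2 : cvgn (series (fun j => Im (v j))).
  by apply: (real_series_cvg r0) => n; exact: le_trans (normr_Im_le _) (vM n).
have h : ccvg (series v) (limn (series (fun j => Re (v j))) +i*
                          limn (series (fun j => Im (v j)))).
  split=> /=.
    by under eq_cvg do rewrite cRe_series.
  by under eq_cvg do rewrite cIm_series.
by rewrite (csumE h).
Qed.

Lemma seriesZ (z : R[i]) v n : series (fun j => z * v j) n = z * series v n.
Proof. by rewrite /series /= mulr_sumr. Qed.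

(** The integrals over the exhausting compact intervals are ln (n + 2). *)
Lemma inv_not_integrable (d : R) : 0 < d ->
  ~ (@lebesgue_measure R).-integrable `]0, d[ (EFin \o (fun t => t^-1)).
Proof.
move=> d0 h; have := exhaust_cvg (exhausts_itv d0) h.
have dln t : [set` `]0, d[ ] t -> is_derive t (1 : R) (@ln R) t^-1.
  by move=> /mem_itvoo/andP[t0 _]; exact: is_derive1_ln.
have cinv : {in [set` `]0, d[ ], continuous (fun t : R => t^-1)}.
  by move=> t /set_mem/mem_itvoo/andP[t0 _]; apply: inv_continuous; rewrite gt_eqF.
under eq_cvg => n.
  rewrite /Rintegral (exhaust_FTC2 n (exhausts_itv d0) cinv dln) -EFinB /=.
  rewrite -ln_div ?posrE ?upper_gt0 ?lower_gt0//.
  rewrite (_ : _ / _ = n.+2%:R); last first.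
    rewrite invfM invrK mulrACA mulfV ?gt_eqF// mul1r mulrBl mul1r mulVf//.
    by rewrite -natr1 addrK.
  over.
move=> hl; have := cvg_seq_bounded (cvgP _ hl).
case=> M [_ /(_ (M + 1)) /(_ _)]; rewrite ltrDl ltr01 => /(_ isT) hM.
pose n := (Num.truncn (expR (M + 1))).
have /= := hM n I; rewrite ger0_norm ?ln_ge0 ?ler1n//.
apply/negP; rewrite -ltNge -ltr_expR lnK ?posrE//.
by rewrite (lt_le_trans (truncnS_gt _))// ler_nat leqnSn.
Qed.

End series.

(** * Termwise integration, and the exponent of integrability *)

(** The function F stands for (x - t)^(alpha - 1) t^(a - 1) times the power series
    with terms u_n t^(2n). The coefficients of index less than n0 vanish:
    when v / k + 1 is a nonpositive integer the Bessel function has such leading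
    coefficients, so that F can be integrable outside the range 0 < Re a, where
    the beta integrals of index less than n0 may diverge. *)
Section termwise.
Context {R : realType}.
Notation mu := (@lebesgue_measure R).
Variables (x : R) (alpha a : R[i]) (u : nat -> R[i]) (C y : R) (F : R -> R[i]).
Hypotheses (x0 : 0 < x) (alpha0 : 0 < Re alpha) (C0 : 0 <= C) (y0 : 0 <= y).
Hypothesis u_le : forall n, normc (u n) <= C * (y ^+ n / n`!%:R).

Let term j t := u j * beta_integrand x alpha (a + (2 * j)%:R) t.

Hypothesis F_cvg : forall t, 0 < t < x -> ccvg (series (term ^~ t)) (F t).
Variable n0 : nat.
Hypothesis u_lt : forall j, (j < n0)%N -> u j = 0.

Lemma normc_term j t : 0 < t < x -> (n0 <= j)%N ->
  normc (term j t) = normc (u j) * (t ^+ 2) ^+ (j - n0) *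
    ((x - t) `^ (Re alpha - 1) * t `^ (Re a + (2 * n0)%:R - 1)).
Proof.
move=> /[dup] t0x /andP[t0 tx] nj; rewrite ComplexField.Normc.normcM normc_beta//.
rewrite cReD cRe_nat -mulrA; congr (_ * _); rewrite mulrCA; congr (_ * _).
have -> : (2 * j)%:R = (2 * n0)%:R + (2 * (j - n0))%:R :> R.
  by rewrite -natrD -mulnDr subnKC.
rewrite (_ : _ - 1 = (2 * (j - n0))%:R + (Re a + (2 * n0)%:R - 1)); last by ring.
by rewrite [LHS]powRD ?(gt_eqF t0) ?implybT// powR_mulrn ?(ltW t0)// exprM.
Qed.

Lemma term_cintegrable j : 0 < Re a + (2 * n0)%:R -> cintegrable `]0, x[ (term j).
Proof.
move=> an0; have [jn|nj] := ltnP j n0.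
  apply: (@eq_cintegrable _ _ (fun=> 0)) => [//|t _|].
    by rewrite /term u_lt ?mul0r.
  by split; exact: integrable0.
apply: cintegrableZl => //; apply: beta_cintegrable => //.
by rewrite cReD cRe_nat (lt_le_trans an0)// lerD2l ler_nat leq_mul.
Qed.

(** Dominated convergence: for t < x the partial sums are bounded by a constant
    multiple of (x - t)^(Re alpha - 1) t^(Re a + 2 n0 - 1). *)
Lemma termwise_integration : 0 < Re a + (2 * n0)%:R ->
  cintegrable `]0, x[ F /\
  ccvg (series (fun j => u j * beta x alpha (a + (2 * j)%:R))) (cintegral `]0, x[ F).
Proof.
move=> an0; have mD := measurable_oo x.
have intE j : cintegral `]0, x[ (term j) = u j * beta x alpha (a + (2 * j)%:R).
  have [jn|nj] := ltnP j n0.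
    rewrite u_lt// mul0r -[RHS](cintegral0 `]0, x[); apply: eq_cintegral => t _.
    by rewrite /term u_lt ?mul0r.
  rewrite cintegralZl//; apply: beta_cintegrable => //.
  by rewrite cReD cRe_nat (lt_le_trans an0)// lerD2l ler_nat leq_mul.
pose h t := (x - t) `^ (Re alpha - 1) * t `^ (Re a + (2 * n0)%:R - 1).
pose X := 1 + x ^+ 2.
have X1 : 1 <= X by rewrite lerDl sqr_ge0.
have yX0 : 0 <= y * X by rewrite mulr_ge0// (le_trans ler01).
have h0 t : 0 <= h t by rewrite mulr_ge0 ?powR_ge0.
have term_le j t : 0 < t < x -> normc (term j t) <= C * ((y * X) ^+ j / j`!%:R) * h t.
  move=> /[dup] t0x /andP[t0 tx]; have [jn|nj] := ltnP j n0.
    rewrite /term u_lt// mul0r ComplexField.Normc.normc0 mulr_ge0// mulr_ge0//.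
    by rewrite divr_ge0// exprn_ge0.
  rewrite normc_term// (ler_wpM2r (h0 t))//.
  rewrite [(y * X) ^+ j]exprMn (mulrAC (y ^+ j)) mulrA.
  rewrite ler_pM ?normc_ge0 ?u_le ?(exprn_ge0 _ (sqr_ge0 t))//.
  (* t^2 <= X, and X >= 1 allows the exponent j - n0 to be raised to j *)
  rewrite (@le_trans _ _ (X ^+ (j - n0)))//.
    rewrite lerXn2r ?nnegrE ?sqr_ge0 ?(le_trans ler01)//.
    by rewrite /X ler_wpDl// !expr2 ler_pM ?(ltW t0) ?(ltW tx).
  by rewrite ler_weXn2l// leq_subr.
have [] := @cdominated R `]0, x[ (fun n t => series (term ^~ t) n) F
  (fun t => C * expR (y * X) * h t) mD.
- move=> n; apply: cintegrable_cmeasurable; apply: cintegrable_sum => // j.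
  exact: term_cintegrable.
- by move=> t /mem_itvoo; exact: F_cvg.
- exact: integrable_mulE (integrable_beta x0 alpha0 an0).
- move=> n t /mem_itvoo t0x; rewrite (le_trans (normc_sum _ _ _))//.
  apply: (@le_trans _ _ (\sum_(0 <= j < n) C * ((y * X) ^+ j / j`!%:R) * h t)).
    by apply: ler_sum => j _; exact: term_le.
  rewrite -mulr_suml -mulr_sumr ler_wpM2r// ler_wpM2l//.
  exact: sum_exp_coeff_le.
move=> Fi Fc; split=> //; apply: ccvg_eq Fc; apply: nearW => n.
rewrite [LHS]cintegral_sum//; last by move=> j; exact: term_cintegrable.
by apply: eq_bigr => j _; exact: intE.
Qed.

(** Near 0 the term of index n0 dominates the others, so that F has at least the
    order t^(Re a + 2 n0 - 1), which is not integrable when the exponent is at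
    most -1. *)
Lemma integrable_exponent : u n0 != 0 -> cintegrable `]0, x[ F ->
  0 < Re a + (2 * n0)%:R.
Proof.
move=> un0 [F1 F2]; have mD := measurable_oo x.
rewrite ltNge; apply/negP; set p := Re a + (2 * n0)%:R => p0.
pose r := Re alpha - 1.
pose h t := (x - t) `^ r * t `^ (p - 1).
have h0 t : 0 <= h t by rewrite mulr_ge0 ?powR_ge0.
pose m := normc (u n0); have m0 : 0 < m.
  by rewrite lt_neqAle normc_ge0 eq_sym normc_eq0 un0.
pose K := C * expR y + 1; have K0 : 0 < K by rewrite ltr_wpDl// mulr_ge0 ?expR_ge0.
(* below d: t < 1 bounds the tail, t < x / 2 keeps (x - t)^r away from 0, and the
   last bound makes the tail at most half of the leading term *)
pose d := Num.min (Num.min 1 (x / 2)) (m / (2 * K)).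
have d0 : 0 < d by rewrite !lt_min ltr01 !divr_gt0// mulr_gt0.
have dP t : 0 < t < d -> [/\ 0 < t, t < 1, t < x / 2 & t ^+ 2 * K <= m / 2].
  rewrite !lt_min => /andP[t0 /andP[/andP[t1 tx] tm]]; split => //.
  rewrite (@le_trans _ _ (t * K))//.
    by rewrite ler_wpM2r ?(ltW K0)// expr2 ler_piMr ?(ltW t0)// ltW.
  rewrite -ler_pdivlMr// (le_trans (ltW tm))// le_eqVlt; apply/orP; left; apply/eqP.
  by field; rewrite gt_eqF.
have partial_ge t n : 0 < t < d -> m / 2 * h t <= normc (series (term ^~ t) (n0 + n.+1)%N).
  move=> /dP[t0 t1 tx2 tm]; have t0x : 0 < t < x by rewrite t0/=; lra.
  have lowz : \sum_(0 <= j < n0) term j t = 0.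
    rewrite big_nat big1// => j /andP[_ jn]; by rewrite /term u_lt ?mul0r.
  rewrite /series /= (big_cat_nat (n := n0))//=; last by rewrite leq_addr.
  rewrite lowz add0r addnS big_nat_recl ?leq_addr//.
  have rest : normc (\sum_(n0 <= j < n0 + n) term j.+1 t) <= m / 2 * h t.
    rewrite (le_trans (normc_sum _ _ _))//.
    apply: (@le_trans _ _ (\sum_(n0 <= j < n0 + n) C * (y ^+ j.+1 / j.+1`!%:R) * t ^+ 2 * h t)).
      rewrite big_nat [leRHS]big_nat; apply: ler_sum => j /andP[nj _].
      rewrite normc_term ?(leq_trans nj)// (ler_wpM2r (h0 t))//.
      rewrite ler_pM ?normc_ge0 ?u_le ?(exprn_ge0 _ (sqr_ge0 t))// subSn// exprS.
      by rewrite ler_piMr ?sqr_ge0// exprn_ile1 ?sqr_ge0// exprn_ile1// ltW.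
    rewrite -mulr_suml ler_wpM2r// -mulr_suml (le_trans _ tm)// mulrC ler_wpM2l ?sqr_ge0//.
    rewrite -mulr_sumr /K ler_wpDr// ler_wpM2l//.
    apply: le_trans (sum_exp_coeff_le (n0 + n).+1 y0).
    rewrite big_nat_recl//= [X in _ <= _ + X](big_cat_nat (n := n0))//= ?leq_addr//.
    rewrite addrA lerDr addr_ge0 ?divr_ge0 ?exprn_ge0//.
    by apply: sumr_ge0 => j _; rewrite divr_ge0 ?exprn_ge0.
  have -> : m / 2 * h t = m * h t - m / 2 * h t by field.
  have firstE : normc (term n0 t) = m * h t.
    by rewrite normc_term// subnn expr0 mulr1.
  rewrite lerBlDr -firstE.
  rewrite (_ : term n0 t = (term n0 t + \sum_(n0 <= i < n0 + n) term i.+1 t) +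
     - \sum_(n0 <= i < n0 + n) term i.+1 t); last by rewrite addrK.
  rewrite (le_trans (le_normcD _ _))// normcN lerD//.
  by rewrite addrK.
have F_ge t : 0 < t < d -> m / 2 * h t <= `|Re (F t)| + `|Im (F t)|.
  move=> td; have /dP[t0 t1 tx2 _] := td.
  have [c1 c2] : ccvg (series (term ^~ t)) (F t) by apply: F_cvg; rewrite t0/=; lra.
  have c : `|Re (series (term ^~ t) n)| + `|Im (series (term ^~ t) n)| @[n --> \oo] -->
      `|Re (F t)| + `|Im (F t)| by apply: cvgD; exact: cvg_norm.
  rewrite leNgt; apply/negP => lt_h; move/cvgr_lt : c => /(_ _ lt_h) [N _ hN].
  have := hN (n0 + N.+1)%N; rewrite /= addnS -addSn leq_addl => /(_ isT).
  apply/negP; rewrite -leNgt; apply: le_trans (normc_le _).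
  by rewrite addSn -addnS; exact: partial_ge.
pose E := (x / 2) `^ (- r) + x `^ (- r).
have E0 : 0 < E by rewrite addr_gt0 ?powR_gt0// divr_gt0.
apply: (inv_not_integrable d0).
have mDd : measurable (`]0, d[ : set R) by [].
have dsub : `]0, d[ `<=` (`]0, x[ : set R).
  move=> t /mem_itvoo /dP[t0 _ tx _]; rewrite /= in_itv/= t0/=; lra.
pose G t := `|Re (F t)| + `|Im (F t)|.
have iG : mu.-integrable `]0, d[ (EFin \o G).
  apply: (@integrableS _ _ _ mu `]0, x[) => //.
  apply: (integrable_ext mD (@integrableD _ _ _ mu `]0, x[ mD _ _
    (integrable_norm F1) (integrable_norm F2))) => t _ //.
pose k := E * (m / 2)^-1.
have k0 : 0 < k by rewrite mulr_gt0// invr_gt0 divr_gt0.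
apply: le_integrable (integrable_mulE k mDd iG) => //.
  apply/measurable_EFinP; apply: open_continuous_measurable_fun.
    exact: interval_open.
  by move=> t /set_mem/mem_itvoo/andP[t0 _]; apply: inv_continuous; rewrite gt_eqF.
move=> t /mem_itvoo td; have [t0 t1 tx _] := dP t td; rewrite lee_fin.
rewrite ger0_norm ?invr_ge0 ?(ltW t0)// (le_trans _ (ler_norm _))//.
rewrite (@le_trans _ _ (k * (m / 2 * h t)))//; last first.
  by rewrite ler_wpM2l ?(ltW k0)// F_ge.
rewrite /k mulrA mulfVK ?gt_eqF ?divr_gt0// /h mulrA.
rewrite -[leLHS]mul1r ler_pM ?invr_ge0 ?(ltW t0)//.
  rewrite -[r]opprK powRN ler_pdivlMr ?powR_gt0 ?subr_gt0 ?mul1r//; last by lra.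
  by apply: powR_le_ends; [rewrite divr_gt0|apply/andP; split; lra].
rewrite -powR_inv1 ?(ltW t0)//; apply: ger_powR; first by rewrite t0 ltW.
by rewrite -[leRHS]add0r lerD2r.
Qed.

End termwise.

(** * The expansion of the k-Bessel function *)

Section bessel.
Context {R : realType}.
Variables (k c : R) (v : R[i]).
Hypothesis k0 : 0 < k.
Let s := v / k%:C.

(** The coefficient of t^(2n + v / k) in the k-Bessel function, with the factor
    [Gammak] rewritten by [GammakE]. *)
Definition bessel_coeff n : R[i] :=
  (cpow (2 * k) s)^-1 * ((- (c / (4 * k)))%:C ^+ n / (Gamma (s + 1 + n%:R) * n`!%:R)).

Lemma kBessel_term (t : R) n : 0 < t ->
  (- c%:C) ^+ n / (Gammak k (n%:R * k%:C + v + k%:C) * n`!%:R)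
    * cpow (t / 2) (2 * n%:R + v / k%:C) =
  bessel_coeff n * cpow t ((2 * n)%:R + s).
Proof.
move=> t0; have kC0 : k%:C != 0 by rewrite fmorph_eq0 gt_eqF.
rewrite GammakE// (_ : (n%:R * k%:C + v + k%:C) / k%:C = s + 1 + n%:R); last first.
  by rewrite /s; field.
rewrite (_ : s + 1 + n%:R - 1 = s + n%:R); last by ring.
rewrite cpowD cpow_nat// natrM -/s.
rewrite (cpowM _ t0) ?invr_gt0// (cpowV _ (ltr0n _ 2)).
rewrite [cpow 2 _]cpowD (_ : cpow 2 (2 * n%:R) = 4 ^+ n); last first.
  rewrite -natrM cpow_nat// exprM; congr (_ ^+ n).
  by rewrite -rmorphXn -natrX rmorph_nat.
rewrite /bessel_coeff cpowM//.
have -> : (- (c / (4 * k)))%:C ^+ n = (- c%:C) ^+ n / (4 ^+ n * k%:C ^+ n) :> R[i].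
  rewrite -exprMn -expr_div_n; congr (_ ^+ n).
  by rewrite rmorphN/= fmorph_div/= rmorphM/= rmorph_nat mulNr.
have p2 := cpow_neq0 2 s; have pk := cpow_neq0 k s.
have fn : n`!%:R != 0 :> R[i] by rewrite pnatr_eq0 -lt0n fact_gt0.
rewrite !invfM; ring.
Qed.

Lemma bessel_coeff_bound : exists2 C : R, 0 <= C &
  forall n, normc (bessel_coeff n) <= C * ((`|c| / (4 * k)) ^+ n / n`!%:R).
Proof.
have [C C0 hC] := invGamma_bounded (s + 1).
exists (normc (cpow (2 * k) s)^-1 * C) => [|n]; first by rewrite mulr_ge0 ?normc_ge0.
rewrite /bessel_coeff [leLHS]ComplexField.Normc.normcM -mulrA ler_wpM2l ?normc_ge0//.
rewrite [(Gamma _ * _)^-1]invfM ![leLHS]ComplexField.Normc.normcM.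
rewrite [normc (_ / _)]ComplexField.Normc.normcM normcX normc_real.
rewrite normrN normf_div [`|4 * k|]gtr0_norm ?mulr_gt0//.
rewrite [normc (_%:R^-1)]ComplexField.Normc.normcV normc_nat mulrCA ler_wpM2r//.
by rewrite divr_ge0// exprn_ge0// divr_ge0// mulr_ge0// ltW.
Qed.

Lemma kBessel_cvg (t : R) : 0 < t ->
  ccvg (series (fun n => bessel_coeff n * cpow t ((2 * n)%:R + s))) (kBessel k v c t).
Proof.
move=> t0; have [C C0 hC] := bessel_coeff_bound.
have -> : kBessel k v c t = csum (fun n => bessel_coeff n * cpow t ((2 * n)%:R + s)).
  by congr csum; apply/funext => n; exact: kBessel_term.
apply: (@ccvg_series _ _ (C * t `^ Re s) (`|c| / (4 * k) * t ^+ 2)).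
  by rewrite mulr_ge0 ?sqr_ge0// divr_ge0// mulr_ge0// ltW.
move=> n; rewrite ComplexField.Normc.normcM normc_cpow// cReD cRe_nat.
rewrite powRD ?(gt_eqF t0) ?implybT// powR_mulrn ?(ltW t0)// exprM.
rewrite [X in _ <= _ * (X / _)]exprMn.
have -> : C * t `^ Re s * ((`|c| / (4 * k)) ^+ n * (t ^+ 2) ^+ n / n`!%:R) =
  C * ((`|c| / (4 * k)) ^+ n / n`!%:R) * ((t ^+ 2) ^+ n * t `^ Re s) by ring.
by rewrite ler_wpM2r// mulr_ge0 ?powR_ge0// exprn_ge0// sqr_ge0.
Qed.

End bessel.

(** * The Erdelyi-Kober transform of the k-Bessel function *)

Unset Implicit Arguments.

Theorem corollary2p3 (R : realType) (k c x : R) (alpha eta lambda v : R[i])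
    (hk : 0 < k) (hx : 0 < x)
    (hv : -1 < complex.Re v) (halpha : 0 < complex.Re alpha) (hlv : 0 < complex.Re (lambda + v)) :
  let f := fun t : R => cpow t (lambda / k%:C - 1) * kBessel k v c t in
  (* the left-hand side exists in the natural range of parameters ... *)
  (0 < complex.Re (v / k%:C + lambda / k%:C + eta) -> EK_defined eta alpha f x) /\
  (* ... and whenever it exists, the identity holds *)
  (EK_defined eta alpha f x ->
   EK eta alpha f x =
     cpow x (v / k%:C + lambda / k%:C - 1) / cpow (2 * k) (v / k%:C)
     * Wright [:: (v / k%:C + lambda / k%:C + eta, 2)]
              [:: (v / k%:C + lambda / k%:C + alpha + eta, 2);
                  (v / k%:C + 1, 1)]
              (- (c * x ^+ 2 / (4 * k)))%:C).
Proof.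
move=> f; set s := v / k%:C; set a := s + lambda / k%:C + eta.
pose u := bessel_coeff k c v.
pose F := EK_integrand eta alpha f x.
have [C C0 u_le] := bessel_coeff_bound c v hk.
have y0 : 0 <= `|c| / (4 * k) by rewrite divr_ge0// mulr_ge0// ltW.
have F_cvg t : 0 < t < x -> ccvg (series
    (fun j => u j * beta_integrand x alpha (a + (2 * j)%:R) t)) (F t).
  move=> /andP[t0 tx].
  have -> : F t = cpow (x - t) (alpha - 1) * cpow t eta * cpow t (lambda / k%:C - 1)
      * kBessel k v c t by rewrite /F /EK_integrand /f !mulrA.
  have := ccvgM (ccvg_cst (cpow (x - t) (alpha - 1) * cpow t eta *
    cpow t (lambda / k%:C - 1))) (kBessel_cvg c v hk t0).
  apply: ccvg_eq; apply: nearW => n; rewrite -seriesZ; congr series.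
  apply/funext => j; rewrite /beta_integrand -/s -/(u j).
  rewrite (_ : a + (2 * j)%:R - 1 = (2 * j)%:R + s + eta + (lambda / k%:C - 1)).
    by rewrite 2![cpow t (_ + _ + _)]cpowD; ring.
  by rewrite /a; ring.
have termwise := termwise_integration hx halpha C0 y0 u_le F_cvg.
split=> [a0|Fi].
  have [] // := termwise 0%N; by rewrite muln0 addr0.
(* where the integral exists, the terms before n0 vanish on both sides and those
   from n0 on have convergent beta integrals; if all coefficients vanish, any large
   n0 will do *)
have [n0 u_lt an0] : exists2 n0, (forall j, (j < n0)%N -> u j = 0) &
    0 < Re a + (2 * n0)%:R.
  have [u_ex|u_all] := pselect (exists n, u n != 0).
    have [n0 un0 n0_min] := ex_minnP u_ex.
    have u_lt j : (j < n0)%N -> u j = 0.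
      by move=> jn; apply/eqP; apply: contraLR jn => uj; rewrite -leqNgt n0_min.
    exists n0 => //.
    exact: (integrable_exponent hx C0 y0 u_le F_cvg u_lt un0 Fi).
  exists (Num.truncn (- Re a)).+1.
    by move=> j _; apply/eqP; apply: contra_notT u_all => uj; exists j.
  have := truncnS_gt (- Re a); rewrite mul2n -addnn natrD.
  have : 0 <= (Num.truncn (- Re a)).+1%:R :> R by [].
  lra.
have [_ Fcvg] := termwise n0 u_lt an0.
set P := cpow x (s + lambda / k%:C - 1) / cpow (2 * k) s.
pose Q := cpow x (- alpha - eta) / Gamma alpha.
have P0 : P != 0 by rewrite mulf_neq0 ?invr_eq0 ?cpow_neq0.
rewrite /EK -/Q -/F /Wright (@csumE _ _ (P^-1 * Q * cintegral `]0, x[ F)).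
  by rewrite -(mulrA P^-1) mulVKf.
have := ccvgM (ccvg_cst (P^-1 * Q)) Fcvg.
apply: ccvg_eq; apply: nearW => n; rewrite -seriesZ; congr series.
apply/funext => j; rewrite !big_cons !big_nil /= !mulr1.
have -> : (2%:C : R[i]) * j%:R = (2 * j)%:R by rewrite rmorph_nat natrM.
have -> : (1%:C : R[i]) * j%:R = j%:R by rewrite rmorph1 mul1r.
have -> : s + lambda / k%:C + alpha + eta + (2 * j)%:R = alpha + (a + (2 * j)%:R).
  by rewrite /a; ring.
have -> : (- (c * x ^+ 2 / (4 * k)))%:C ^+ j =
    (- (c / (4 * k)))%:C ^+ j * (x%:C ^+ 2) ^+ j :> R[i].
  rewrite -[RHS]exprMn; congr (_ ^+ j).
  by rewrite -rmorphXn -rmorphM/= mulNr [c / _ * _]mulrAC.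
have k2 := cpow_neq0 (2 * k) s.
have uE : (- (c / (4 * k)))%:C ^+ j / (Gamma (s + 1 + j%:R) * j`!%:R) =
    cpow (2 * k) s * u j by rewrite /u /bessel_coeff -/s mulVKf.
transitivity (Gamma (a + (2 * j)%:R) / Gamma (alpha + (a + (2 * j)%:R)) *
    (x%:C ^+ 2) ^+ j * ((- (c / (4 * k)))%:C ^+ j / (Gamma (s + 1 + j%:R) * j`!%:R))).
  rewrite uE -/(u j); have [jn|nj] := ltnP j n0; first by rewrite u_lt// !(mul0r, mulr0).
  have aj0 : 0 < Re (a + (2 * j)%:R).
    by rewrite cReD cRe_nat (lt_le_trans an0)// lerD2l ler_nat leq_mul.
  rewrite betaE// /P /Q.
  have -> : cpow x (alpha + (a + (2 * j)%:R) - 1) =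
      cpow x (s + lambda / k%:C - 1) * (cpow x (- alpha - eta))^-1 * (x%:C ^+ 2) ^+ j.
    rewrite -cpowN -exprM -(cpow_nat (2 * j)%N hx) -!cpowD; congr cpow.
    by rewrite /a; ring.
  have g1 := Gamma_neq0 halpha.
  have g2 : Gamma (alpha + (a + (2 * j)%:R)) != 0.
    by rewrite Gamma_neq0// cReD addr_gt0.
  have x1 := cpow_neq0 x (s + lambda / k%:C - 1).
  have x2 := cpow_neq0 x (- alpha - eta).
  by field; rewrite k2 g1 g2 x1 x2.
rewrite !invfM; ring.
Qed.
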